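(* Let $n\ge2$, let $\pi:\mathcal S^+(n)\to\mathcal S^+(n)/\mathrm{Diag}^+(n)$, $\pi(\Sigma)=\Sigma\star\mathrm{Diag}^+(n)$, be the quotient Riemannian submersion for $g^{\mathrm{LE}}$ and $g^Q$, and let $\Phi^{\mathrm{LS\text{-}OL}}:=\Phi_{\mathrm{OL}}\circ\Phi_{\mathrm{LS}}^{-1}:(\mathrm{Cor}^+(n),g^{\mathrm{LS}})\to(\mathrm{Cor}^+(n),g^{\mathrm{OL}})$ be the explicit Riemannian isometry between the log-scaling and off-log metrics. Then the log-scaling metric on full-rank correlation matrices is $$g^{\mathrm{LS}}=(\pi\circ\Phi^{\mathrm{LS\text{-}OL}})^*(g^Q).$$
   Context: $\mathcal S(k)$ = real symmetric $k\times k$ matrices, $\mathcal S^+(k)$ = symmetric positive-definite ones, $\mathrm{Cor}^+(n)$ = matrices in $\mathcal S^+(n)$ with unit diagonal, $\mathrm{Hol}(n)$ = symmetric matrices with zero diagonal, $\mathrm{Row}_0(n)$ = symmetric matrices with zero row sums, $\mathrm{Diag}(n)$, $\mathrm{Diag}^+(n)$ = diagonal matrices, resp. with positive diagonal. $\mathrm{Diag}(A)$ is the diagonal part of $A$ and $\mathrm{off}(A)=A-\mathrm{Diag}(A)$; $\exp,\log$ are the matrix exponential and logarithm; $\langle A,B\rangle=\mathrm{tr}(AB)$. The group law on $\mathcal S^+(n)$ is $\Sigma_1\star\Sigma_2=\exp(\log\Sigma_1+\log\Sigma_2)$ and $\mathcal S^+(n)/\mathrm{Diag}^+(n)$ is the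 quotient by the subgroup $\mathrm{Diag}^+(n)$. $g^{\mathrm{LE}}=\log^*\langle\cdot,\cdot\rangle$ on $\mathcal S^+(n)$, and $g^Q$ is the unique metric on the quotient making $\pi$ a Riemannian submersion. For each $S\in\mathcal S(n)$ there is a unique $\mathcal D(S)\in\mathrm{Diag}(n)$ with $\exp(S+\mathcal D(S))\in\mathrm{Cor}^+(n)$; $\mathrm{Log}=\mathrm{off}\circ\log:\mathrm{Cor}^+(n)\to\mathrm{Hol}(n)$ is a diffeomorphism with inverse $S\mapsto\exp(S+\mathcal D(S))$, and $g^{\mathrm{OL}}=\mathrm{Log}^*\langle\cdot,\cdot\rangle$. For each $\Sigma\in\mathcal S^+(n)$ there is a unique $\mathcal D^*(\Sigma)\in\mathrm{Diag}^+(n)$ with $\log(\mathcal D^*(\Sigma)\Sigma\mathcal D^*(\Sigma))\in\mathrm{Row}_0(n)$; $\mathrm{Log}^\bullet:\mathrm{Cor}^+(n)\to\mathrm{Row}_0(n)$, $C\mapsto\log(\mathcal D^*(C)C\mathcal D^*(C))$, is a diffeomorphism with inverse $S\mapsto\pi_1(\exp S)$, $\pi_1(\Sigma)=\mathrm{Diag}(\Sigma)^{-1/2}\Sigma\,\mathrm{Diag}(\Sigma)^{-1/2}$, and $g^{\mathrm{LS}}=(\mathrm{Log}^\bullet)^*\langle\cdot,\cdot\rangle$. $\Phi_{\mathrm{OL}},\Phi_{\mathrm{LS}}:\mathcal S^+(n-1)\to\mathrm{Cor}^+(n)$ are the diffeomorphisms $\Phi_{\mathrm{OL}}(X)=\exp(\mathcal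 D(\psi_{\mathrm{OL}}(\log X))+\psi_{\mathrm{OL}}(\log X))$ and $\Phi_{\mathrm{LS}}(X)=\pi_1(\exp(B_n^\top\log(X)B_n))$. Here $\psi_{\mathrm{OL}}:\mathcal S(n-1)\to\mathrm{Hol}(n)$ is the linear isomorphism $\psi_{\mathrm{OL}}(S)=\begin{bmatrix}0&\frac1{\sqrt2}\mathrm{diag}(S)^\top\\\frac1{\sqrt2}\mathrm{diag}(S)&\mathrm{off}(S)\end{bmatrix}$ (with $\mathrm{diag}(S)$ the column vector of diagonal entries), and $B_n\in\mathbb R^{(n-1)\times n}$ has $i$-th row with entries $\frac1{\sqrt{i(i+1)}}$ in columns $1,\dots,i$, $-\frac{i}{\sqrt{i(i+1)}}$ in column $i+1$, and $0$ elsewhere. *)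

(* Defs.v *)
From HB Require Import structures.
From mathcomp Require Import all_boot all_order all_algebra.
From mathcomp Require Import all_classical all_reals.
From mathcomp Require Import topology normedtype sequences derive.

Set Implicit Arguments.
Unset Strict Implicit.
Unset Printing Implicit Defensive.

Import Order.TTheory GRing.Theory Num.Theory.
Import numFieldNormedType.Exports.
Local Open Scope classical_set_scope.
Local Open Scope ring_scope.

Section MatrixSets.
Context {R : realType} {n : nat}.
Implicit Types A : 'M[R]_n.

Definition symm : set 'M[R]_n := [set A | A^T = A].

Definition spd : set 'M[R]_n :=
  [set A | symm A /\ forall x : 'cV[R]_n, x != 0 -> 0 < (x^T *m A *m x) 0 0].

Definition corr : set 'M[R]_n := [set A | spd A /\ forall i, A i i = 1].

Definition hol : set 'M[R]_n := [set A | symm A /\ forall i, A i i = 0].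

Definition row0 : set 'M[R]_n := [set A | symm A /\ forall i, \sum_j A i j = 0].

Definition diagonal : set 'M[R]_n := [set A | is_diag_mx A].

Definition pdiagonal : set 'M[R]_n :=
  [set A | diagonal A /\ forall i, 0 < A i i].

Definition diag_part A : 'M[R]_n := diag_mx (\row_i A i i).

Definition off A : 'M[R]_n := A - diag_part A.

Lemma spd1 : spd 1%:M.
Proof.
split=> [|x x0]; first exact: trmx1.
rewrite mulmx1 mxE lt_neqAle sumr_ge0 ?andbT; last first.
  by move=> i _; rewrite mxE -expr2 sqr_ge0.
apply: contra x0; rewrite eq_sym psumr_eq0; last first.
  by move=> i _; rewrite mxE -expr2 sqr_ge0.
move=> /allP xi0; apply/eqP/colP => i.
by have /implyP := xi0 i (mem_index_enum i); rewrite !mxE mulf_eq0 orbb => /(_ isT)/eqP.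
Qed.

End MatrixSets.

Section ExpLog.
Context {R : realType} {n : nat}.
Implicit Types A S : 'M[R]_n.

Definition mexp A : 'M[R]_n := limn (series (fun k => k`!%:R^-1 *: A ^+ k)).

(* Only meaningful on spd, where the symmetric logarithm exists uniquely; the
   default value 0 is arbitrary.  The same convention applies below. *)
Definition mlog A : 'M[R]_n := xget 0 [set S | symm S /\ mexp S = A].

Definition star A B : 'M[R]_n := mexp (mlog A + mlog B).

Definition coset A : set 'M[R]_n := [set star A D | D in pdiagonal].

Definition off_log_diag S : 'M[R]_n :=
  xget 0 [set D | diagonal D /\ corr (mexp (S + D))].

Definition scaling A : 'M[R]_n :=
  xget 1%:M [set D | pdiagonal D /\ row0 (mlog (D *m A *m D))].

Definition log_scaling C : 'M[R]_n := mlog (scaling C *m C *m scaling C).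

Definition corr_of A : 'M[R]_n :=
  let D := diag_mx (\row_i (Num.sqrt (A i i))^-1) in D *m A *m D.

End ExpLog.

Section Diffeomorphisms.
Context {R : realType} {m : nat}.

Definition psi_OL (S : 'M[R]_m) : 'M[R]_m.+1 :=
  let d := \col_i ((Num.sqrt 2)^-1 * S i i) in
  @block_mx R 1 m 1 m 0 d^T d (off S).

(* Indices start at 0: row i of this matrix is the (i+1)-st row of B_(m+1). *)
Definition Bmx : 'M[R]_(m, m.+1) :=
  \matrix_(i < m, j < m.+1)
    if (j <= i)%N then (Num.sqrt (i.+1 * i.+2)%:R)^-1
    else if j == i.+1 :> nat then - (i.+1%:R / Num.sqrt (i.+1 * i.+2)%:R)
    else 0.

Definition Phi_OL (X : 'M[R]_m) : 'M[R]_m.+1 :=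
  let S := psi_OL (mlog X) in mexp (off_log_diag S + S).

Definition Phi_LS (X : 'M[R]_m) : 'M[R]_m.+1 :=
  corr_of (mexp (Bmx^T *m mlog X *m Bmx)).

Definition Phi_LS_inv (C : 'M[R]_m.+1) : 'M[R]_m :=
  xget 1%:M [set X | spd X /\ Phi_LS X = C].

Definition Phi_LS_OL : 'M[R]_m.+1 -> 'M[R]_m.+1 := Phi_OL \o Phi_LS_inv.

End Diffeomorphisms.

Section MatrixMetrics.
Context {R : realType} {n : nat}.

(* A metric on a submanifold of the matrices is given by its values g x u v at
   the points x of the submanifold and the tangent vectors u, v at x.  The
   tangent space is symm at every point of spd, and hol at every point of corr
   (spd is open in symm, corr is open in the affine space 1 + hol). *)
Definition metric := 'M[R]_n -> 'M[R]_n -> 'M[R]_n -> R.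

(* f ^* <.,.>.  As the submanifolds above are open in affine spaces, 'D_u f x
   only depends on the values of f on the submanifold when u is tangent. *)
Definition pullback_frobenius (f : 'M[R]_n -> 'M[R]_n) : metric :=
  fun x u v => \tr ('D_u f x *m 'D_v f x).

Definition g_LE : metric := pullback_frobenius mlog.

Definition g_LS : metric := pullback_frobenius log_scaling.

Fixpoint Ck (k : nat) (U : set 'M[R]_n) (f : 'M[R]_n -> R) : Prop :=
  match k with
  | 0 => forall x, U x -> {for x, continuous f}
  | k'.+1 => (forall x, U x -> differentiable f x) /\
             forall v, Ck k' U (fun x => 'D_v f x)
  end.

(* Smoothness on a submanifold A that need not be open in the space of all
   matrices: existence of local smooth extensions. *)
Definition smooth_on (A : set 'M[R]_n) (f : 'M[R]_n -> R) : Prop :=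
  forall x, A x -> exists (U : set 'M[R]_n) (F : 'M[R]_n -> R),
    [/\ open U, U x, forall k, Ck k U F & forall y, U y -> A y -> F y = f y].

End MatrixMetrics.

Arguments metric : clear implicits.

(* The quotient manifold is described intrinsically through its algebra of
   smooth functions: f is smooth on the quotient iff f \o coset_proj is smooth on spd
   (this determines the unique smooth structure making coset_proj a submersion).
   Tangent vectors are derivations of this algebra. *)
Section Quotient.
Context {R : realType} {n : nat}.

Definition quot := {q : set 'M[R]_n | (coset @` spd) q}.

(* coset_proj A = coset A for A in spd; the value outside spd is irrelevant. *)
Definition coset_proj (A : 'M[R]_n) : quot :=
  match pselect (spd A) with
  | left spdA => exist _ (coset A) (imageP coset spdA)
  | right _ => exist _ (coset 1%:M) (imageP coset spd1)
  end.

Definition smooth_quot (f : quot -> R) : Prop := smooth_on spd (f \o coset_proj).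

Definition Coo := {f : quot -> R | smooth_quot f}.

Definition ev (f : Coo) (q : quot) : R := sval f q.

Definition tangent (q : quot) : set (Coo -> R) := [set v |
  (forall (a : R) (f g h : Coo),
     (forall p, ev h p = a * ev f p + ev g p) -> v h = a * v f + v g) /\
  (forall f g h : Coo,
     (forall p, ev h p = ev f p * ev g p) ->
     v h = ev f q * v g + v f * ev g q)].

(* The differential at x, in the direction u, of a map into the quotient. *)
Definition dquot (F : 'M[R]_n -> quot) (x u : 'M[R]_n) : Coo -> R :=
  fun f => 'D_u (ev f \o F : 'M[R]_n -> R) x.

Definition quot_metric := quot -> (Coo -> R) -> (Coo -> R) -> R.

Definition smooth_field (X : quot -> Coo -> R) : Prop :=
  (forall q, tangent q (X q)) /\ forall f, smooth_quot (X ^~ f).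

Definition is_riemannian (g : quot_metric) : Prop :=
  [/\ forall q u v, tangent q u -> tangent q v -> g q u v = g q v u,
      forall q (a : R) u v w, tangent q u -> tangent q v -> tangent q w ->
        g q (fun f => a * u f + v f) w = a * g q u w + g q v w,
      forall q u, tangent q u -> u <> (fun _ => 0) -> 0 < g q u u &
      forall X Y, smooth_field X -> smooth_field Y ->
        smooth_quot (fun q => g q (X q) (Y q))].

Definition horizontal (g : metric R n) (A u : 'M[R]_n) : Prop :=
  symm u /\
  forall v, symm v -> dquot coset_proj A v = (fun _ => 0) -> g A u v = 0.

(* coset_proj is smooth and onto by construction. *)
Definition riemannian_submersion_coset_proj (g : metric R n) (gQ : quot_metric) :=
  [/\ is_riemannian gQ,
      forall A, spd A ->
        forall w, tangent (coset_proj A) w -> exists2 u, symm u & dquot coset_proj A u = w &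
      forall A, spd A -> forall u v, horizontal g A u -> horizontal g A v ->
        gQ (coset_proj A) (dquot coset_proj A u) (dquot coset_proj A v) = g A u v].

Definition pullback_quot (F : 'M[R]_n -> quot) (gQ : quot_metric) : metric R n :=
  fun x u v => gQ (F x) (dquot F x u) (dquot F x v).

End Quotient.

Arguments quot_metric : clear implicits.

(* Main.v *)
(** Write L for Log^bullet, W(C) = psi_OL(B L(C) B^T) and A(C) = exp(W(C)). The
    diagonal correction in Phi_OL does not change the coset, so that
    (pi o Phi^LS-OL)(C) = pi(A(C)), whatever the value of that correction.
    The tangent vector a = dA(u) satisfies dlog(a) = dW(u), which has zero
    diagonal, whereas dlog(v) is diagonal for every vertical v: indeed the
    off-diagonal entries of log are smooth functions on the quotient. Hence a
    is horizontal and g^Q(dpi a, dpi b) = <dW(u), dW(v)> = <dL(u), dL(v)>,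
    because psi_OL and S |-> B S B^T are isometric.

    Two analytic facts are needed. First, log is smooth near a positive
    definite matrix A0: after conjugation and rescaling it is the series of
    log(1 - X), the rows of X having l1-norm less than 1, and the derivative of a matrix power
    series at X along V is a block of the same series at [X V; 0 X], which lets
    differentiability be iterated. Second, L is differentiable: the vector d
    with d_i (C d)_i = 1 exists as the critical point of a coercive potential,
    and its increments solve a uniformly coercive linear system. *)

From HB Require Import structures.
From mathcomp Require Import all_boot all_order all_algebra.
From mathcomp Require Import spectral complex ring lra zify.
From mathcomp Require Import all_classical all_reals.
From mathcomp Require Import topology normedtype landau sequences derive exp realfun.
Require Import Defs.
Set Implicit Arguments.
Unset Strict Implicit.
Unset Printing Implicit Defensive.
Import Order.TTheory GRing.Theory Num.Theory.
Import numFieldNormedType.Exports.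
Local Open Scope classical_set_scope.
Local Open Scope ring_scope.

(** * The spectral theorem for real symmetric matrices *)

(** Every directional derivative is therefore read as the derivative at 0 of a curve with a real
    parameter that stays in [spd], and two functions are compared only along such a curve. The
    equation d_i (C d)_i = 1 comes from the vector 1 of ones: for symmetric S, S kills 1 iff exp S
    fixes it, so log(D C D) has zero row sums iff D C D has unit row sums. The solution d can be
    differentiated without an implicit function theorem, because 1/d - 1/e = (e - d)/(d e) is exact:
    increments of d solve a linear system with no remainder, and coercivity bounds its inverse
    uniformly near C. *)

Lemma sqnorm_eq0 (R : realDomainType) n (x : 'rV[R]_n) : (x *m x^T) 0 0 = 0 -> x = 0.
Proof.
rewrite mxE => /eqP; rewrite psumr_eq0; last first.
  by move=> i _; rewrite mxE -expr2 sqr_ge0.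
move=> /allP xi0; apply/rowP => i.
by have := xi0 i (mem_index_enum i); rewrite !mxE mulf_eq0 orbb => /eqP.
Qed.

Lemma sqnorm_ge0 (R : realDomainType) n (x : 'rV[R]_n) : 0 <= (x *m x^T) 0 0.
Proof. by rewrite mxE sumr_ge0// => i _; rewrite mxE -expr2 sqr_ge0. Qed.

(* The real or the imaginary part of a complex eigenvector is a real one. *)
Lemma symmetric_eigenvector (R : rcfType) n (A : 'M[R]_n.+1) : A^T = A ->
  exists (a : R) (x : 'rV[R]_n.+1), x != 0 /\ x *m A = a *: x.
Proof.
move=> sA.
pose C := complex.complex R; pose rc := complex.real_complex R : R -> C.
have [a /eigenvalueP[z zA z0]] := eigenvalue_closed (map_mx rc A) (ltn0Sn n).
pose x := map_mx (@complex.Re R) z; pose y := map_mx (@complex.Im R) z.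
have xA : x *m A = complex.Re a *: x - complex.Im a *: y.
  apply/rowP => j; move/rowP/(_ j) : zA; rewrite !mxE => /(congr1 (@complex.Re R)).
  rewrite (raddf_sum (@complex.Re R : {additive complex.Rcomplex R -> R})) => e.
  transitivity (complex.Re (a * z 0 j)).
    by rewrite -e; apply: eq_bigr => k _; rewrite !mxE; case: (z 0 k) => p q /=;
      rewrite mulr0 subr0.
  by case: (a) (z 0 j) => p q [].
have yA : y *m A = complex.Re a *: y + complex.Im a *: x.
  apply/rowP => j; move/rowP/(_ j) : zA; rewrite !mxE => /(congr1 (@complex.Im R)).
  rewrite (raddf_sum (@complex.Im R : {additive complex.Rcomplex R -> R})) => e.
  transitivity (complex.Im (a * z 0 j)).
    by rewrite -e; apply: eq_bigr => k _; rewrite !mxE; case: (z 0 k) => p q /=;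
      rewrite mulr0 add0r.
  by case: (a) (z 0 j) => p q [].
(* Evaluating both sides with [xA] and [yA] gives Im a (x x^T + y y^T) = 0, so either a is real or z
   = x + i y vanishes. *)
have : x *m A *m y^T = x *m (y *m A)^T by rewrite trmx_mul sA mulmxA.
rewrite xA yA mulmxBl [(_ + _)^T]linearD /= ![(_ *: _)^T]linearZ mulmxDr -!scalemxAl -!scalemxAr /=.
move=> /addrI/eqP; rewrite eq_sym -subr_eq0 opprK -scalerDr scaler_eq0 => /orP[/eqP b0|/eqP].
  move: xA yA; rewrite b0 !scale0r subr0 addr0 => xA yA.
  have [x0|x0] := eqVneq x 0; last by exists (complex.Re a), x.
  exists (complex.Re a), y; split=> //; apply: contra z0 => /eqP y0.
  apply/eqP/rowP => j; move/rowP/(_ j): x0; move/rowP/(_ j): y0.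
  by rewrite !mxE; case: (z 0 j) => p q /= -> ->.
move=> /matrixP/(_ 0 0)/eqP; rewrite !mxE.
have := paddr_eq0 (sqnorm_ge0 x) (sqnorm_ge0 y); rewrite !mxE => -> /andP[/eqP xx /eqP yy].
have x0 : x = 0 by apply: sqnorm_eq0; rewrite mxE.
have y0 : y = 0 by apply: sqnorm_eq0; rewrite mxE.
case/negP: z0; apply/eqP/rowP => j; move/rowP/(_ j): x0; move/rowP/(_ j): y0.
by rewrite !mxE; case: (z 0 j) => p q /= -> ->.
Qed.

(* The Householder reflection that exchanges x and the first basis vector. *)
Lemma orthogonal_with_row0 (R : rcfType) n (x : 'rV[R]_n.+1) : x *m x^T = 1%:M ->
  exists2 P : 'M[R]_n.+1, P *m P^T = 1%:M & row 0 P = x.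
Proof.
move=> x1; pose e : 'rV[R]_n.+1 := delta_mx 0 0; 
have [w wE] : exists w, w = x - e by exists (x - e).
have e1 : e *m e^T = 1%:M.
  by rewrite trmx_delta mul_delta_mx; apply/matrixP=> i j; rewrite !mxE !ord1.
have [w0|w0] := eqVneq w 0.
  exists 1%:M; first by rewrite trmx1 mulmx1.
  by rewrite row1; move/eqP: w0; rewrite wE subr_eq0 => /eqP.
pose q := (w *m w^T) 0 0.
have q0 : q != 0 by apply: contra w0 => /eqP/sqnorm_eq0 ->.
have wq : w *m w^T = q%:M by rewrite [LHS]mx11_scalar.
pose H := 1%:M - (2 / q) *: (w^T *m w).
have tH : H^T = H.
  by rewrite /H linearB/= linearZ/= trmx_mul trmxK trmx1.
exists H.
  have HH : w^T *m w *m (w^T *m w) = q *: (w^T *m w).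
    by rewrite mulmxA -(mulmxA _ w) wq mul_mx_scalar -scalemxAl.
  rewrite tH /H mulmxBl mul1mx mulmxBr mulmx1 -scalemxAl -!scalemxAr HH !scalerA.
  rewrite -addrA -[RHS]addr0; congr (_ + _).
  rewrite opprB addrCA addrC -addrA -!(scaleNr _ (_ *m w)) -!scalerDl.
  rewrite (_ : _ + _ = 0) ?scale0r//; field.
  exact: q0.
rewrite rowE /H mulmxBr mulmx1 -scalemxAr mulmxA.
(* As x and e are unit vectors, q = |x - e|^2 = 2 - 2 e x^T = -2 e w^T. Hence e H = e + w = x. *)
have ew : 2 *: (e *m w^T) = - q%:M.
  rewrite -wq wE linearB/= !mulmxBl !mulmxBr e1 x1.
  have -> : x *m e^T = e *m x^T.
    by rewrite -[LHS]trmxK trmx_mul trmxK [LHS]mx11_scalar [RHS]mx11_scalar mxE.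
  rewrite scaler_nat mulr2n opprB; apply/matrixP => i j.
  by move: (e *m x^T) (1%:M : 'M[R]_1) => u v; rewrite !mxE; ring.
rewrite -/e [2 / q]mulrC -scalerA [2 *: _]scalemxAl ew mulNmx mul_scalar_mx scalerN.
rewrite scalerA mulVf// scale1r.
by rewrite opprK wE addrC subrK.
Qed.

(** Deflation: in an orthonormal basis that starts with a unit eigenvector, the first row of the
    matrix is a multiple of the first basis vector, and by symmetry so is the first column. The
    remaining block is symmetric and one size smaller. *)
Lemma symmetric_spectral (R : rcfType) n (A : 'M[R]_n) : A^T = A ->
  exists (P : 'M[R]_n) (d : 'rV[R]_n), P *m P^T = 1%:M /\ A = P^T *m diag_mx d *m P.
Proof.
elim: n A => [|n IH] A sA.
  by exists 1%:M, 0; split; [apply/matrixP; case|apply/matrixP; case].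
have [a [x0 [x00 xA0]]] := symmetric_eigenvector sA.
have q0 : 0 < (x0 *m x0^T) 0 0.
  rewrite lt_neqAle sqnorm_ge0 andbT eq_sym.
  by apply: contra x00 => /eqP/sqnorm_eq0 ->.
have [x xx xA] : exists2 x : 'rV[R]_n.+1, x *m x^T = 1%:M & x *m A = a *: x.
  exists ((Num.sqrt ((x0 *m x0^T) 0 0))^-1 *: x0).
    rewrite linearZ/= -scalemxAl -scalemxAr scalerA -invfM -expr2 sqr_sqrtr ?ltW//.
    by rewrite [x0 *m _]mx11_scalar scale_scalar_mx mxE eqxx mulr1n mulVf// gt_eqF.
  by rewrite -scalemxAl xA0 scalerA mulrC -scalerA.
have [P PP rP] := orthogonal_with_row0 xx.
have PP' := mulmx1C PP.
have [B BE] : exists B : 'M[R]_(1 + n), B = P *m A *m P^T by exists (P *m A *m P^T).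
have sB : B^T = B by rewrite BE !trmx_mul trmxK sA mulmxA.
have rB : row 0 B = a *: delta_mx 0 0.
  rewrite BE !row_mul rP xA -scalemxAl; congr (_ *: _).
  by rewrite -rP -row_mul PP row1.
have B0 j : B 0 j = a * (j == 0)%:R.
  by move/rowP/(_ j): rB; rewrite !mxE.
have eB : B = block_mx a%:M 0 0 (drsubmx B).
  rewrite -[LHS]submxK; congr block_mx.
  - apply/matrixP => i j; rewrite !mxE !ord1 lshift0 B0/= mulr1 mulr1n.
    by [].
  - by apply/matrixP => i j; rewrite !mxE !ord1 lshift0 B0 mulr0.
  - apply/matrixP => i j; rewrite !mxE !ord1 lshift0 -sB mxE B0 mulr0.
    by [].
have [Q [d [QQ dE]]] := IH (drsubmx B) (etrans (trmx_drsub B) (congr1 drsubmx sB)).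
exists ((block_mx 1%:M 0 0 Q : 'M[R]_(1 + n)) *m P), (row_mx a%:M d : 'rV[R]_(1 + n)); split.
  rewrite trmx_mul mulmxA -(mulmxA _ P) PP mulmx1 (@tr_block_mx _ 1 n 1 n).
  rewrite (@mulmx_block _ 1 n 1 n 1 n).
  by rewrite !trmx0 trmx1 !mulmx1 !mulmx0 !mul0mx !addr0 add0r QQ -scalar_mx_block.
have dd : @diag_mx _ n.+1 (row_mx a%:M d : 'rV[R]_(1 + n)) =
    block_mx (diag_mx a%:M) 0 0 (diag_mx d).
  by rewrite -(diag_mx_row (a%:M : 'rV_1) d).
rewrite trmx_mul (@tr_block_mx _ 1 n 1 n) trmx1 !trmx0 dd !mulmxA.
rewrite -(mulmxA P^T) -(mulmxA P^T) !(@mulmx_block _ 1 n 1 n 1 n).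
rewrite !mulmx0 !mul0mx !mulmx1 !mul1mx !addr0 !add0r.
rewrite !mul0mx -dE.
have -> : diag_mx (a%:M : 'rV[R]_1) = a%:M.
  by apply/matrixP => i j; rewrite !ord1 !mxE.
by rewrite -eB BE !mulmxA PP' mul1mx -mulmxA PP' mulmx1.
Qed.

(** * Matrix power series *)

Lemma cvg_sumr (R : realType) (V : normedModType R) (T I : Type) (F : set_system T)
  (FF : Filter F) (s : seq I) (f : I -> T -> V) (l : I -> V) :
  (forall i, f i x @[x --> F] --> l i) ->
  \sum_(i <- s) f i x @[x --> F] --> \sum_(i <- s) l i.
Proof. by move=> fl; apply: (cvg_big add_continuous) => i _; exact: fl. Qed.

Lemma mx_linear_continuous (R : realType) m n (W : normedModType R)
  (L : {linear 'M[R]_(m, n) -> W}) : continuous L.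
Proof.
have -> : L = (fun X => \sum_i \sum_j X i j *: L (delta_mx i j)) :> (_ -> _).
  apply/funext => X; rewrite {1}(matrix_sum_delta X) linear_sum.
  by apply: eq_bigr => i _; rewrite linear_sum; apply: eq_bigr => j _; rewrite linearZ.
move=> X; have FX : Filter (nbhs X) := nbhs_filter X.
apply: (@cvg_sumr _ _ _ _ (nbhs X)) => i; apply: (@cvg_sumr _ _ _ _ (nbhs X)) => j.
by apply: (@cvgZr_tmp _ _ _ (nbhs X)); exact: coord_continuous.
Qed.

Lemma is_diff_quadratic (R : realType) (V W : normedModType R) (f : V -> W)
  (x : V) (df : {linear V -> W}) (K : R) : continuous df ->
  (\forall h \near (0 : V), `|f (h + x) - f x - df h| <= K * `|h| ^+ 2) ->
  is_diff x f df.
Proof.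
move=> cdf fK.
have e : f \o shift x = cst (f x) + df +o_ 0 id.
  apply/eqaddoP => e e0; near=> h => /=.
  rewrite /cst /= [X in `|X|](_ : _ = f (h + x) - f x - df h); last first.
    by rewrite opprD addrA.
  (* The denominator |K| + 1 is positive whatever the sign of [K], and K |h|^2 <= e |h| below this
     threshold. *)
  have h0 : `|h| <= e / (`|K| + 1).
    by near: h; apply: nbhs0_le; rewrite divr_gt0// ltr_wpDl.
  apply: le_trans (near fK h _) _ => //.
  rewrite expr2 mulrA ler_wpM2r//.
  apply: le_trans (ler_wpM2r (normr_ge0 _) (ler_norm K)) _.
  move: h0; rewrite ler_pdivlMr ?ltr_wpDl// mulrC; apply: le_trans.
  by rewrite ler_wpM2r// lerDl.
have d := diff_unique cdf e.
by split => //; apply/diff_locallyP; rewrite d.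
Unshelve. all: by end_near. Qed.

Lemma mx_nbhs0_le (R : realType) m n (e : R) : 0 < e ->
  \forall X \near (0 : 'M[R]_(m, n)), `|X| <= e.
Proof. exact: nbhs0_le. Qed.

Section MatrixPowerSeries.
Context {R : realType}.
Implicit Types (a : nat -> R) (r : R).

(** A bound on the operator norm for the sup norm on columns. Unlike the entrywise maximum [|X|], it
    is submultiplicative with constant 1, so powers are bounded by powers. *)
Definition rowsums_le n r (X : 'M[R]_n) := forall i, \sum_j `|X i j| <= r.

Lemma rowsums_leW n r s (X : 'M[R]_n) : r <= s -> rowsums_le r X -> rowsums_le s X.
Proof. by move=> rs Xr i; apply: le_trans rs. Qed.

Lemma rowsums_entry n r (X : 'M[R]_n) i j : rowsums_le r X -> `|X i j| <= r.
Proof.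
move=> Xr; apply: le_trans (Xr i); rewrite (bigD1 j)//= lerDl.
by rewrite sumr_ge0.
Qed.

Lemma rowsums0 n r : 0 <= r -> rowsums_le r (0 : 'M[R]_n).
Proof. by move=> r0 i; rewrite big1// => j _; rewrite mxE normr0. Qed.

Lemma rowsumsD n r s (X Y : 'M[R]_n) :
  rowsums_le r X -> rowsums_le s Y -> rowsums_le (r + s) (X + Y).
Proof.
move=> Xr Ys i; apply: le_trans (lerD (Xr i) (Ys i)).
by rewrite -big_split ler_sum// => j _; rewrite mxE ler_normD.
Qed.

Lemma rowsumsZ n r (c : R) (X : 'M[R]_n) :
  rowsums_le r X -> rowsums_le (`|c| * r) (c *: X).
Proof.
move=> Xr i; apply: le_trans (ler_wpM2l (normr_ge0 c) (Xr i)).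
by rewrite mulr_sumr ler_sum// => j _; rewrite mxE normrM.
Qed.

Lemma rowsumsM n r s (X Y : 'M[R]_n) : 0 <= s ->
  rowsums_le r X -> rowsums_le s Y -> rowsums_le (r * s) (X *m Y).
Proof.
move=> s0 Xr Ys i.
apply: (@le_trans _ _ (\sum_k `|X i k| * s)); last first.
  by rewrite -mulr_suml ler_wpM2r.
apply: (@le_trans _ _ (\sum_j \sum_k `|X i k| * `|Y k j|)).
  apply: ler_sum => j _; rewrite mxE; apply: le_trans (ler_norm_sum _ _ _) _.
  by apply: ler_sum => k _; rewrite normrM.
rewrite exchange_big; apply: ler_sum => k _.
by rewrite -mulr_sumr ler_wpM2l.
Qed.

Lemma rowsumsX n r (X : 'M[R]_n) k : 0 <= r ->
  rowsums_le r X -> rowsums_le (r ^+ k) (X ^+ k).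
Proof.
move=> r0 Xr; elim: k => [|k IH].
  move=> i; rewrite expr0 expr0 (bigD1 i)//= mxE eqxx normr1 big1 ?addr0//.
  by move=> j ji; rewrite mxE eq_sym (negbTE ji) normr0.
by rewrite !exprS; apply: rowsumsM => //; apply: exprn_ge0.
Qed.

Lemma rowsums_norm n (X : 'M[R]_n) : rowsums_le (n%:R * `|X|) X.
Proof.
move=> i; apply: (@le_trans _ _ (\sum_(j < n) `|X|)).
  apply: ler_sum => j _; rewrite [leRHS]/Num.norm/= mx_normrE.
  exact: (le_bigmax _ (fun ij => `|X ij.1 ij.2|) (i, j)).
by rewrite sumr_const card_ord mulr_natl.
Qed.

Lemma mx_norm_le m n (X : 'M[R]_(m, n)) (e : R) : 0 <= e ->
  (forall i j, `|X i j| <= e) -> `|X| <= e.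
Proof.
move=> e0 Xe; rewrite [leLHS]/Num.norm/= mx_normrE.
by apply: bigmax_le => // -[i j] _; exact: Xe.
Qed.

Lemma ler_mx_entry m n (X : 'M[R]_(m, n)) i j : `|X i j| <= `|X|.
Proof.
rewrite [leRHS]/Num.norm/= mx_normrE.
exact: (le_bigmax _ (fun ij => `|X ij.1 ij.2|) (i, j)).
Qed.

Definition mxps a n (X : 'M[R]_n) : 'M[R]_n :=
  \matrix_(i, j) limn (series (fun k => a k * (X ^+ k) i j)).

(* The upper right block of the k-th power is the derivative of X ^+ k along V. *)
Definition dblock n (X V : 'M[R]_n) : 'M[R]_(n + n) := block_mx X V 0 X.

Definition dpow n (X V : 'M[R]_n) k := ursubmx (dblock X V ^+ k).

Lemma dblockX n (X V : 'M[R]_n) k :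
  dblock X V ^+ k = block_mx (X ^+ k) (dpow X V k) 0 (X ^+ k).
Proof.
suff [e1 e2 e3] : [/\ ulsubmx (dblock X V ^+ k) = X ^+ k, dlsubmx (dblock X V ^+ k) = 0 &
  drsubmx (dblock X V ^+ k) = X ^+ k] by rewrite -[LHS]submxK e1 e2 e3.
elim: k => [|k [e1 e2 e3]].
  by rewrite !expr0 [1]scalar_mx_block block_mxKul block_mxKdl block_mxKdr.
rewrite !exprSr -{1 2 3}[_ ^+ k]submxK e1 e2 e3 -!mulmxE mulmx_block.
by rewrite block_mxKul block_mxKdl block_mxKdr !mul0mx !mulmx0 !addr0 !add0r.
Qed.

Lemma dpow0 n (X V : 'M[R]_n) : dpow X V 0 = 0.
Proof. by rewrite /dpow expr0 [1]scalar_mx_block block_mxKur. Qed.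

Lemma dpowS n (X V : 'M[R]_n) k : dpow X V k.+1 = X ^+ k *m V + dpow X V k *m X.
Proof.
by rewrite {1}/dpow exprSr dblockX -mulmxE mulmx_block block_mxKur.
Qed.

Lemma dpow_linear n (X : 'M[R]_n) k c U V :
  dpow X (c *: U + V) k = c *: dpow X U k + dpow X V k.
Proof.
elim: k => [|k IH]; first by rewrite !dpow0 scaler0 addr0.
rewrite !dpowS IH mulmxDr mulmxDl -!scalemxAl -!scalemxAr scalerDr.
by rewrite addrACA.
Qed.

Lemma rowsums_dpow n r (v : R) (X V : 'M[R]_n) k : 0 < r -> 0 <= v ->
  rowsums_le r X -> rowsums_le v V -> rowsums_le (k%:R * r ^+ k * (v / r)) (dpow X V k).
Proof.
move=> r0 v0 Xr Vv; elim: k => [|k IH].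
  by rewrite dpow0; apply: rowsums0; rewrite !mul0r.
rewrite dpowS; apply: rowsums_leW (rowsumsD (rowsumsM v0 (rowsumsX k (ltW r0) Xr) Vv)
  (rowsumsM (ltW r0) IH Xr)).
rewrite le_eqVlt; apply/orP; left; apply/eqP.
by rewrite -natr1 exprS; field; rewrite gt_eqF.
Qed.

(** The remainders E_k satisfy E_(k+1) = E_k (V + X) + [dpow X V k] V, so the constants grow by k at
    each step, and k^2 + k <= (k + 1)^2. *)
Lemma rowsums_taylor n r (v : R) (X V : 'M[R]_n) k : 0 < r -> 0 <= v ->
  rowsums_le r X -> rowsums_le r (V + X) -> rowsums_le v V ->
  rowsums_le (k%:R ^+ 2 * r ^+ k * (v / r) ^+ 2) ((V + X) ^+ k - X ^+ k - dpow X V k).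
Proof.
move=> r0 v0 Xr XVr Vv; elim: k => [|k IH].
  rewrite !expr0 subrr dpow0 subr0; apply: rowsums0.
  by rewrite expr0n !mul0r.
have -> : (V + X) ^+ k.+1 - X ^+ k.+1 - dpow X V k.+1 =
    ((V + X) ^+ k - X ^+ k - dpow X V k) *m (V + X) + dpow X V k *m V.
  rewrite dpowS !exprSr -!mulmxE !mulmxBl !mulmxDr.
  move: (_ *m _) (_ *m _) (_ *m _) (_ *m _) (_ *m _) (_ *m _) => x1 x2 x3 x4 x5 x6.
  by apply/matrixP => i j; rewrite !mxE; ring.
apply: rowsums_leW (rowsumsD (rowsumsM (ltW r0) IH XVr)
  (rowsumsM v0 (rowsums_dpow k r0 v0 Xr Vv) Vv)).
rewrite -natr1 [r ^+ k.+1]exprS -subr_ge0.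
rewrite (_ : _ - _ = (k%:R + 1) * r ^+ k.+1 * (v / r) ^+ 2); last first.
  by rewrite [r ^+ k.+1]exprS; field; rewrite gt_eqF.
by have r0' := ltW r0; rewrite !mulr_ge0 ?addr_ge0 ?exprn_ge0 ?divr_ge0 ?invr_ge0.
Qed.

(** The weight (k + 1)^2 dominates at once the factors 1, k and k^2 found in the bounds of X^k, of
    its derivative and of its second-order remainder, including at k = 0. *)
Definition summable2 a r := cvgn (series (fun k => `|a k| * k.+1%:R ^+ 2 * r ^+ k)).

Definition sum2 a r := limn (series (fun k => `|a k| * k.+1%:R ^+ 2 * r ^+ k)).

Lemma summable2_dominated a r (M : R) (u : nat -> R) : 0 <= r -> 0 <= M -> summable2 a r ->
  (forall k, `|u k| <= M * (k.+1%:R ^+ 2 * r ^+ k)) ->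
  cvgn (series (fun k => a k * u k)) /\
  `|limn (series (fun k => a k * u k))| <= M * sum2 a r.
Proof.
move=> r0 M0 ar uM.
have cM : cvgn (series (M *: (fun k => `|a k| * k.+1%:R ^+ 2 * r ^+ k))).
  exact: is_cvg_seriesZ.
have auM k : `|a k * u k| <= (M *: (fun k => `|a k| * k.+1%:R ^+ 2 * r ^+ k)) k.
  rewrite normrM.
  change (`|a k| * `|u k| <= M * (`|a k| * k.+1%:R ^+ 2 * r ^+ k)).
  by rewrite -[X in M * X]mulrA [leRHS]mulrCA ler_wpM2l.
have cn : cvgn [normed series (fun k => a k * u k)].
  apply: (series_le_cvg _ _ auM cM) => k; first exact: normr_ge0.
  exact: le_trans (normr_ge0 _) (auM k).
split; first exact: normed_cvg.
apply: le_trans (lim_series_norm cn) _.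
apply: le_trans (lim_series_le cn cM auM) _.
by rewrite lim_seriesZ.
Qed.

Lemma sum2_ge0 a r : 0 <= r -> summable2 a r -> 0 <= sum2 a r.
Proof.
move=> r0 ar.
have H k : `|(fun=> 0 : R) k| <= 1 * (k.+1%:R ^+ 2 * r ^+ k) :> R.
  by rewrite normr0 mul1r mulr_ge0 ?sqr_ge0 ?exprn_ge0.
by have [_ /(le_trans (normr_ge0 _))] := summable2_dominated r0 ler01 ar H; rewrite mul1r.
Qed.

Lemma summable2_cvg a r n (X : 'M[R]_n) i j : 0 <= r -> summable2 a r -> rowsums_le r X ->
  cvgn (series (fun k => a k * (X ^+ k) i j)).
Proof.
move=> r0 ar Xr; apply: (summable2_dominated (M := 1) r0 _ ar _).1 => // k.
apply: le_trans (rowsums_entry i j (rowsumsX k r0 Xr)) _.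
rewrite mul1r ler_peMl ?exprn_ge0// exprn_ege1// ler1n.
by [].
Qed.

Lemma summable2_dpow a r n (X V : 'M[R]_n) i j : 0 < r -> summable2 a r -> rowsums_le r X ->
  cvgn (series (fun k => a k * (dpow X V k) i j)).
Proof.
move=> r0 ar Xr; pose v := n%:R * `|V|.
have v0 : 0 <= v by rewrite mulr_ge0.
apply: (summable2_dominated (M := v / r) (ltW r0) _ ar _).1 => [|k].
  by rewrite divr_ge0// ltW.
apply: le_trans (rowsums_entry i j (rowsums_dpow k r0 v0 Xr (@rowsums_norm _ V))) _.
rewrite mulrC ler_wpM2l ?divr_ge0 ?(ltW r0)// ler_wpM2r ?exprn_ge0 ?(ltW r0)//.
by rewrite -natrX ler_nat (leq_trans (leqnSn k))// -{1}[k.+1]expn1 leq_pexp2l.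
Qed.

Definition dmxps a n (X V : 'M[R]_n) : 'M[R]_n := ursubmx (mxps a (dblock X V)).

Lemma dmxpsE a n (X V : 'M[R]_n) i j :
  dmxps a X V i j = limn (series (fun k => a k * (dpow X V k) i j)).
Proof.
rewrite !mxE; congr (limn (series _)); apply/funext => k.
by rewrite dblockX block_mxEur.
Qed.

Lemma dmxps_linear a r n (X : 'M[R]_n) : 0 < r -> summable2 a r -> rowsums_le r X ->
  linear (dmxps a X).
Proof.
move=> r0 ar Xr c U V; apply/matrixP => i j.
pose f W k := a k * (dpow X W k) i j.
have cf W : cvgn (series (f W)) by exact: summable2_dpow r0 ar Xr.
have fE : f (c *: U + V) = c *: f U + f V.
  apply/funext => k; rewrite /f dpow_linear mxE [X in a k * (X + _)]mxE mulrDr mulrCA.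
  by [].
rewrite dmxpsE -/(f _) fE (lim_seriesD (is_cvg_seriesZ (cf U)) (cf V)).
rewrite (lim_seriesZ c (cf U)).
by rewrite 2!mxE !dmxpsE.
Qed.

(** The gap between r and r' is the room for the increment: X and V + X both have row sums at most
    r', where the termwise Taylor remainders are summable. *)
Lemma is_diff_mxps a r r' n (X : 'M[R]_n) : 0 < r -> r < r' -> summable2 a r' -> rowsums_le r X ->
  is_diff X (@mxps a n) (dmxps a X).
Proof.
move=> r0 rr' ar' Xr.
have r'0 := lt_trans r0 rr'.
have Xr' := rowsums_leW (ltW rr') Xr.
have [L LE] : exists L : {linear 'M[R]_n -> 'M[R]_n}, L = dmxps a X :> (_ -> _).
  pose Lm := GRing.isLinear.Build _ _ _ _ (dmxps a X) (dmxps_linear r'0 ar' Xr').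
  pose L : {linear 'M[R]_n -> 'M[R]_n} := HB.pack (dmxps a X) Lm.
  by exists L.
rewrite -LE.
(* The factor (v / r')^2 of [rowsums_taylor] for v = n |V|, summed against the coefficients, is K
   |V|^2. *)
pose K := n%:R ^+ 2 / r' ^+ 2 * sum2 a r'.
apply: (@is_diff_quadratic _ _ _ _ _ L K); first exact: mx_linear_continuous.
near=> V; rewrite LE.
have nV : n%:R * `|V| <= r' - r.
  apply: (@le_trans _ _ (n.+1%:R * `|V|)); first by rewrite ler_wpM2r// ler_nat.
  rewrite mulrC -ler_pdivlMr//.
  by near: V; apply: mx_nbhs0_le; rewrite divr_gt0 ?subr_gt0.
have VXr' : rowsums_le r' (V + X).
  by rewrite -[r'](subrK r); apply: rowsumsD Xr; apply: rowsums_leW nV (rowsums_norm V).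
have v0 : 0 <= n%:R * `|V| by rewrite mulr_ge0.
have K0 : 0 <= (n%:R * `|V| / r') ^+ 2 := sqr_ge0 _.
suff B i j : `|(mxps a (V + X) - mxps a X - dmxps a X V) i j| <= K * `|V| ^+ 2.
  apply: mx_norm_le B; rewrite /K mulr_ge0 ?sqr_ge0// mulr_ge0 ?divr_ge0 ?sqr_ge0//.
  exact: sum2_ge0 (ltW r'0) _.
pose F (Y : nat -> 'M[R]_n) k := a k * Y k i j.
have c1 : cvgn (series (F (fun k => (V + X) ^+ k))) by exact: summable2_cvg (ltW r'0) ar' VXr'.
have c2 : cvgn (series (F (fun k => X ^+ k))) by exact: summable2_cvg (ltW r'0) ar' Xr'.
have c3 : cvgn (series (F (dpow X V))) by exact: summable2_dpow r'0 ar' Xr'.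
have c4 : cvgn (series (F (fun k => (V + X) ^+ k) - F (fun k => X ^+ k))).
  exact: is_cvg_seriesB.
have FE : F (fun k => (V + X) ^+ k) - F (fun k => X ^+ k) - F (dpow X V) =
    (fun k => a k * ((V + X) ^+ k - X ^+ k - dpow X V k) i j).
  apply/funext => k.
  have -> (A B C : 'M[R]_n) : (A - B - C) i j = A i j - B i j - C i j by rewrite !mxE.
  by rewrite !mulrBr.
have H k : `|((V + X) ^+ k - X ^+ k - dpow X V k) i j| <=
    (n%:R * `|V| / r') ^+ 2 * (k.+1%:R ^+ 2 * r' ^+ k).
  apply: le_trans (rowsums_entry i j (rowsums_taylor k r'0 v0 Xr' VXr' (@rowsums_norm _ V))) _.
  rewrite mulrC ler_wpM2l// ler_wpM2r ?exprn_ge0 ?(ltW r'0)//.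
  by rewrite ler_sqr ?nnegrE// ler_nat.
have [_] := summable2_dominated (ltW r'0) K0 ar' H.
rewrite -FE (lim_seriesB c4 c3) (lim_seriesB c1 c2).
have -> : K * `|V| ^+ 2 = (n%:R * `|V| / r') ^+ 2 * sum2 a r'.
  by rewrite /K !exprMn exprVn; ring.
apply: le_trans; rewrite le_eqVlt; apply/orP; left; apply/eqP; congr `|_|.
by rewrite !mxE -dmxpsE !mxE.
Unshelve. all: by end_near. Qed.

End MatrixPowerSeries.

(** * The scalar series of exp and of -log(1 - x) *)

Section ScalarSeries.
Context {R : realType}.

(* If r = t^4 then (k + 1) t^k is bounded and t^(2 k) is summable. *)
Lemma is_cvg_sqr_geometric (r : R) : 0 < r < 1 ->
  cvgn (series (fun k => k.+1%:R ^+ 2 * r ^+ k)).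
Proof.
move=> /andP[r0 r1].
pose t := Num.sqrt (Num.sqrt r).
have t0 : 0 < t by rewrite !sqrtr_gt0.
have t2 : t ^+ 2 = Num.sqrt r by rewrite sqr_sqrtr ?sqrtr_ge0.
have t4 : t ^+ 2 * t ^+ 2 = r by rewrite t2 -expr2 sqr_sqrtr ?ltW.
have t1 : t < 1.
  rewrite ltNge; apply/negP => t1; move: r1; rewrite -t4 ltNge => /negP; apply.
  by rewrite -exprD exprn_ege1.
(* Each of the k + 1 terms of 1 + t + ... + t^k = (1 - t^(k+1)) / (1 - t) is at least t^k. *)
have b k : k.+1%:R * t ^+ k <= (1 - t)^-1.
  rewrite -[leRHS]mul1r ler_pdivlMr ?subr_gt0//.
  apply: (@le_trans _ _ (1 - t ^+ k.+1)); last by rewrite gerBl exprn_ge0// ltW.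
  rewrite -[leRHS]opprB subrX1 -mulNr opprB mulrC ler_wpM2l ?subr_ge0 ?(ltW t1)//.
  rewrite -[k.+1 in leLHS]card_ord mulr_natl -sumr_const.
  apply: ler_sum => i _; rewrite ler_wiXn2l ?(ltW t0) ?(ltW t1)//.
  by rewrite -ltnS.
apply: (@series_le_cvg _ _ (geometric ((1 - t)^-1 ^+ 2) (t ^+ 2))).
- by move=> k; rewrite mulr_ge0 ?sqr_ge0 ?exprn_ge0 ?(ltW r0).
- move=> k /=; rewrite mulr_ge0 ?sqr_ge0 ?exprn_ge0 ?(ltW t0)//.
- move=> k /=; rewrite -{1}t4 exprMn mulrA ler_wpM2r ?exprn_ge0 ?(ltW t0)//.
  rewrite -exprM mulnC exprM -exprMn ler_sqr ?nnegrE ?mulr_ge0 ?exprn_ge0 ?(ltW t0)//.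
  by rewrite invr_ge0 subr_ge0 ltW.
apply: is_cvg_geometric_series; rewrite ger0_norm ?sqr_ge0//.
by rewrite expr_lt1 ?(ltW t0).
Qed.

Definition exp_coef (k : nat) : R := k`!%:R^-1.

(* k = 0 gives 0^-1 = 0. *)
Definition log_coef (k : nat) : R := k%:R^-1.

Lemma summable2_log r : 0 < r < 1 -> summable2 log_coef r.
Proof.
move=> r01; apply: series_le_cvg (is_cvg_sqr_geometric r01) => k.
- by rewrite !mulr_ge0 ?sqr_ge0 ?exprn_ge0//; case/andP: r01 => /ltW.
- by rewrite mulr_ge0 ?sqr_ge0 ?exprn_ge0//; case/andP: r01 => /ltW.
rewrite -mulrA ler_piMl//.
  by rewrite mulr_ge0 ?sqr_ge0 ?exprn_ge0//; case/andP: r01 => /ltW.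
rewrite ger0_norm ?invr_ge0//; case: k => [|k]; first by rewrite /log_coef invr0.
by rewrite /log_coef invf_le1 ?ler1n.
Qed.

Lemma summable2_exp r : 0 <= r -> summable2 exp_coef r.
Proof.
(* The comparison series uses (k + 1)^2 <= 4 * 2^k, the 2^k being absorbed into exp(2 r). *)
move=> r0; have c : cvgn (series (4 *: exp_coeff (2 * r))).
  by apply: is_cvg_seriesZ; exact: is_cvg_series_exp_coeff.
apply: series_le_cvg c => k.
- by rewrite !mulr_ge0 ?sqr_ge0 ?exprn_ge0.
- by rewrite /exp_coeff/= mulr_ge0// divr_ge0// exprn_ge0// mulr_ge0.
change (`|exp_coef k| * k.+1%:R ^+ 2 * r ^+ k <= 4 * ((2 * r) ^+ k / k`!%:R)).
rewrite ger0_norm ?invr_ge0// /exp_coef exprMn.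
rewrite [leRHS](_ : _ = k`!%:R^-1 * (4 * 2 ^+ k) * r ^+ k); last by ring.
rewrite ler_wpM2r ?exprn_ge0// ler_wpM2l ?invr_ge0//.
rewrite -!natrX -natrM ler_nat.
(* The induction step needs (k + 2)^2 <= 2 (k + 1)^2, which fails for k = 0 and 1; the exponents 0,
   1 and 2 are computed. *)
elim: k => [//|[//|[//|k]] IH]; rewrite [(2 ^ k.+3)%N]expnS mulnCA.
by apply: leq_trans (leq_mul (leqnn 2) IH); rewrite -!mulnn; nia.
Qed.

(** The termwise derivative of the sum is the geometric series 1 / (1 - y), so the sum plus ln(1 -
    y) has zero derivative; it is constant, and it vanishes at 0. *)
Lemma cvg_log_series (x : R) : `|x| < 1 ->
  series (fun k => log_coef k * x ^+ k) @ \oo --> - ln (1 - x).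
Proof.
move=> x1.
have [K /andP[xK K1]] : exists K : R, `|x| < K < 1.
  by exists ((`|x| + 1) / 2); rewrite midf_lt//= midf_lt.
have K0 : 0 < K by apply: le_lt_trans xK.
(* Termwise differentiation inside |y| < K asks for convergence at K of the series and of its first
   two formal derivatives. Their coefficients are at most 1, 1 and k + 1, all below (k + 1)^2. *)
have cK (c : nat -> R) : (forall k, 0 <= c k <= k.+1%:R ^+ 2) -> cvgn (pseries c K).
  move=> cb; have /(is_cvg_sqr_geometric) : 0 < K < 1 by rewrite K0.
  apply: series_le_cvg => k; have /andP[c0 c1] := cb k.
  - by rewrite mulr_ge0// exprn_ge0// ltW.
  - by rewrite mulr_ge0 ?sqr_ge0// exprn_ge0// ltW.
  - by rewrite ler_wpM2r// exprn_ge0// ltW.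
have lc k : 0 <= log_coef k <= 1.
  case: k => [|k]; rewrite /log_coef ?invr0 ?lexx ?ler01//.
  by rewrite invr_ge0 ler0n invf_le1 ?ler1n.
have d1 k : pseries_diffs log_coef k = 1 by rewrite /pseries_diffs /log_coef divff ?pnatr_eq0.
have d2 k : pseries_diffs (pseries_diffs log_coef) k = k.+1%:R.
  by rewrite {1}/pseries_diffs d1 mulr1.
have sq1 k : (1 : R) <= k.+1%:R ^+ 2 by rewrite exprn_ege1// ler1n.
have c0 : cvgn (pseries log_coef K).
  by apply: cK => k; have /andP[-> /le_trans ->] := lc k.
have c1 : cvgn (pseries (pseries_diffs log_coef) K).
  by apply: cK => k; rewrite d1 ler01 sq1.
have c2 : cvgn (pseries (pseries_diffs (pseries_diffs log_coef)) K).
  by apply: cK => k; rewrite d2 ler0n ler_eXnr// ler1n.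
pose g (y : R) : R := limn (pseries log_coef y).
have dg (y : R) : `|y| < K -> is_derive y 1 g (1 - y)^-1.
  move=> yK; have := @pseries_snd_diffs _ log_coef K y c0 c1 c2.
  rewrite (ger0_norm (ltW K0)) => /(_ yK).
  rewrite (_ : limn _ = (1 - y)^-1)//.
  have := @cvg_geometric_series _ 1 y (lt_trans yK K1).
  rewrite mul1r; move/cvg_lim => <-//; congr (limn (series _)).
  by apply/funext => k /=; rewrite d1.
pose h (y : R) : R := g y + ln (1 - y).
have dh (y : R) : `|y| < K -> is_derive y 1 h 0.
  move=> yK; have := dg y yK => dgy.
  have y1 : 0 < 1 - y by rewrite subr_gt0; apply: le_lt_trans (ler_norm y) (lt_trans yK K1).
  have dl := is_derive1_ln y1.
  have d1y : is_derive y 1 (fun y : R => 1 - y) (-1).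
    by apply: is_derive_eq; rewrite add0r mul1r.
  have dly := @is_derive1_comp R (@ln R) (fun y : R => 1 - y) y _ _ dl d1y.
  have := is_deriveD dgy dly; rewrite mulrN1 subrr.
  by [].
have hc p q : p < q -> `|p| < K -> `|q| < K -> h p = h q.
  move=> pq pK qK.
  have inK y : y \in `[p, q] -> `|y| < K.
    rewrite in_itv/= ltr_norml => /andP[py yq]; move: pK qK.
    rewrite !ltr_norml => /andP[Kp _] /andP[_ qK].
    by rewrite (lt_le_trans Kp py) (le_lt_trans yq qK).
  have [| |c _] := @MVT R h (fun=> 0) p q pq.
  - by move=> y yI; apply/dh/inK; move: yI; rewrite !in_itv/= => /andP[/ltW -> /ltW ->].
  - apply: derivable_within_continuous => y /inK yK.
    by have [] := dh y yK.
  by rewrite mul0r => /eqP; rewrite subr_eq0 => /eqP ->.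
have hx : h x = h 0.
  by have [x0|x0|->//] := ltgtP x 0; [|apply/esym]; apply: hc; rewrite ?normr0.
have g0 : g 0 = 0.
  rewrite /g (_ : pseries _ _ = cst 0) ?lim_cst//.
  apply/funext => k; rewrite /pseries/= /series/= big1// => i _.
  by case: i => [|i]; rewrite /log_coef ?invr0 ?mul0r// expr0n mulr0.
have gx : g x = - ln (1 - x).
  move: hx; rewrite /h g0 subr0 ln1 addr0 => /eqP.
  by rewrite addr_eq0 => /eqP.
rewrite -gx; apply: is_cvg_pseries_inside c0 _.
by rewrite (ger0_norm (ltW K0)).
Qed.

Lemma cvg_exp_series (x : R) : series (fun k => exp_coef k * x ^+ k) @ \oo --> expR x.
Proof.
rewrite (_ : (fun k => _) = exp_coeff x); first exact: is_cvg_series_exp_coeff.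
by apply/funext => k; rewrite /exp_coef /exp_coeff /= mulrC.
Qed.
End ScalarSeries.

(** * The matrix exponential and logarithm *)

Section MatrixExpLog.
Context {R : realType}.

(** Each entry of a partial sum is a fixed finite combination of the scalar partial sums at the
    eigenvalues, so convergence at the eigenvalues suffices. *)
Lemma mxps_spectral (a : nat -> R) (f : R -> R) n (P : 'M[R]_n) (d : 'rV[R]_n) :
  P *m P^T = 1%:M ->
  (forall i, series (fun k => a k * d 0 i ^+ k) @ \oo --> f (d 0 i)) ->
  mxps a (P^T *m diag_mx d *m P) = P^T *m diag_mx (map_mx f d) *m P.
Proof.
move=> PP fd; have PP' := mulmx1C PP.
have diagE (e : 'rV[R]_n) i j : (P^T *m diag_mx e *m P) i j = \sum_l P l i * P l j * e 0 l.
  by rewrite mul_mx_diag mxE; apply: eq_bigr => l _; rewrite !mxE mulrAC.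
have pw k : (P^T *m diag_mx d *m P) ^+ k = P^T *m diag_mx (map_mx (fun x => x ^+ k) d) *m P.
  elim: k => [|k IH].
    rewrite expr0 (_ : map_mx _ d = const_mx 1) ?diag_const_mx ?mulmx1 ?PP'//.
    by apply/rowP => i; rewrite !mxE expr0.
  rewrite exprSr IH -mulmxE !mulmxA -(mulmxA _ P) PP mulmx1 -(mulmxA _ (diag_mx _)).
  rewrite mulmx_diag; congr (_ *m diag_mx _ *m _).
  by apply/rowP => i; rewrite !mxE exprSr.
apply/matrixP => i j; rewrite mxE diagE.
have -> : series (fun k => a k * ((P^T *m diag_mx d *m P) ^+ k) i j) =
    (fun N => \sum_l (P l i * P l j) *: series (fun k => a k * d 0 l ^+ k) N).
  apply/funext => N; rewrite /series /=.
  under [RHS]eq_bigr do rewrite scaler_sumr.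
  rewrite exchange_big; apply: eq_bigr => k _.
  rewrite pw diagE mulr_sumr; apply: eq_bigr => l _; rewrite !mxE /=.
  by rewrite /GRing.scale/= mulrCA.
apply/cvg_lim => //; apply: cvg_sumr => l.
by apply: cvgZl_tmp; rewrite mxE; exact: fd.
Qed.

Lemma cvg_mx_entries m n (T : Type) (F : set_system T) (FF : Filter F)
  (u : T -> 'M[R]_(m, n)) (l : 'M[R]_(m, n)) :
  (forall i j, (fun k => u k i j) @ F --> l i j) -> u @ F --> l.
Proof.
move=> ul; apply/cvgrPdist_le => /= e e0.
have : \forall k \near F, forall ij : 'I_m * 'I_n, `|l ij.1 ij.2 - u k ij.1 ij.2| <= e.
  by apply: filter_forall => ij; move/cvgrPdist_le : (ul ij.1 ij.2); exact.
apply: filterS => k lu; apply: mx_norm_le; first exact: ltW.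
by move=> i j; rewrite !mxE; exact: (lu (i, j)).
Qed.

(** [mexp] is a limit of matrices and [mxps] a matrix of limits; the two agree because every entry
    converges. *)
Lemma mexpE n (X : 'M[R]_n) : mexp X = mxps exp_coef X.
Proof.
rewrite /mexp; apply/cvg_lim => //; apply: cvg_mx_entries => i j.
have r0 : 0 <= n%:R * `|X| by rewrite mulr_ge0.
have c := summable2_cvg (i := i) (j := j) r0 (summable2_exp r0) (@rowsums_norm _ _ X).
rewrite mxE; move: c; rewrite /series/=.
rewrite (_ : (fun N : nat => (\sum_(0 <= k < N) k`!%:R^-1 *: X ^+ k) i j) =
  (fun N : nat => \sum_(0 <= k < N) exp_coef k * (X ^+ k) i j))//.
by apply/funext => N; rewrite summxE; apply: eq_bigr => k _; rewrite mxE.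
Qed.

Lemma differentiable_mexp n (X : 'M[R]_n) : differentiable (@mexp R n) X.
Proof.
have -> : @mexp R n = @mxps _ exp_coef n by apply/funext => Y; rewrite mexpE.
pose r := n%:R * `|X| + 1.
have r0 : 0 < r by rewrite ltr_wpDl ?mulr_ge0.
have [] // := @is_diff_mxps _ exp_coef r (r + 1) n X r0 _ _ _.
- by rewrite ltrDl.
- by apply: summable2_exp; rewrite addr_ge0 ?ltW.
- by apply: rowsums_leW (@rowsums_norm _ _ X); rewrite lerDl.
Qed.

Lemma mexp_spectral n (P : 'M[R]_n) (d : 'rV[R]_n) : P *m P^T = 1%:M ->
  mexp (P^T *m diag_mx d *m P) = P^T *m diag_mx (map_mx expR d) *m P.
Proof.
by move=> PP; rewrite mexpE (mxps_spectral (f := expR))// => i; exact: cvg_exp_series.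
Qed.

Lemma symm_conj n (P : 'M[R]_n) (d : 'rV[R]_n) : symm (P^T *m diag_mx d *m P).
Proof. by rewrite /symm/= !trmx_mul trmxK tr_diag_mx mulmxA. Qed.

Lemma quad_conj n (P : 'M[R]_n) (d : 'rV[R]_n) (x : 'cV[R]_n) :
  (x^T *m (P^T *m diag_mx d *m P) *m x) 0 0 = \sum_i d 0 i * ((P *m x) i 0) ^+ 2.
Proof.
rewrite !mulmxA -trmx_mul -mulmxA mul_mx_diag mxE.
by apply: eq_bigr => i _; rewrite !mxE; ring.
Qed.

Lemma spd_conj n (P : 'M[R]_n) (d : 'rV[R]_n) : P *m P^T = 1%:M ->
  (forall i, 0 < d 0 i) -> spd (P^T *m diag_mx d *m P).
Proof.
move=> PP d0; split; first exact: symm_conj.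
move=> x x0; rewrite quad_conj lt_neqAle sumr_ge0 ?andbT; last first.
  by move=> i _; rewrite mulr_ge0 ?sqr_ge0// ltW.
apply: contra x0; rewrite eq_sym psumr_eq0; last first.
  by move=> i _; rewrite mulr_ge0 ?sqr_ge0// ltW.
move=> /allP Px; have Px0 : P *m x = 0.
  apply/colP => i; have := Px i (mem_index_enum i).
  by rewrite mulf_eq0 gt_eqF//= sqrf_eq0 => /eqP ->; rewrite mxE.
by rewrite -[x]mul1mx -(mulmx1C PP) -mulmxA Px0 mulmx0.
Qed.

Lemma spd_spectral n (A : 'M[R]_n) : spd A ->
  exists (P : 'M[R]_n) (d : 'rV[R]_n),
  [/\ P *m P^T = 1%:M, forall i, 0 < d 0 i & A = P^T *m diag_mx d *m P].
Proof.
move=> [sA pA]; have [P [d [PP AE]]] := symmetric_spectral sA.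
exists P, d; split=> // i.
pose x : 'cV[R]_n := P^T *m delta_mx i 0.
have Px : P *m x = delta_mx i 0 by rewrite mulmxA PP mul1mx.
have x0 : x != 0.
  apply/eqP => x0; move: Px; rewrite x0 mulmx0 => /matrixP/(_ i 0)/eqP.
  by rewrite !mxE !eqxx eq_sym oner_eq0.
have := pA x x0; rewrite AE quad_conj Px (bigD1 i)//= big1 => [|j ji].
  by rewrite !mxE !eqxx expr1n mulr1 addr0.
by rewrite !mxE (negbTE ji) expr0n mulr0.
Qed.

Lemma mexp_symm n (S : 'M[R]_n) : symm S -> spd (mexp S).
Proof.
move=> /symmetric_spectral[P [d [PP ->]]]; rewrite mexp_spectral//.
by apply: spd_conj => // i; rewrite mxE expR_gt0.
Qed.

(* If P diagonalises S and Q diagonalises T, the entries of P Q^T link equal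
   eigenvalues only, and exp is injective on eigenvalues. *)
Lemma mexp_inj n (S T : 'M[R]_n) : symm S -> symm T -> mexp S = mexp T -> S = T.
Proof.
move=> /symmetric_spectral[P [d [PP ->]]] /symmetric_spectral[Q [e [QQ ->]]].
rewrite !mexp_spectral// => E.
have PP' := mulmx1C PP; have QQ' := mulmx1C QQ.
pose M := P *m Q^T.
have entry (f : R -> R) : diag_mx (map_mx f d) *m M = M *m diag_mx (map_mx f e) <->
    P^T *m diag_mx (map_mx f d) *m P = Q^T *m diag_mx (map_mx f e) *m Q.
  split=> H; last first.
    transitivity (P *m (P^T *m diag_mx (map_mx f d) *m P) *m Q^T).
      by rewrite /M !mulmxA PP mul1mx.
    by rewrite H /M !mulmxA -mulmxA QQ mulmx1.
  rewrite -[LHS]mulmx1 -QQ' !mulmxA -(mulmxA _ P) -/M -(mulmxA _ _ M) H.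
  by rewrite /M !mulmxA PP' mul1mx.
have /entry/matrixP ME := E.
have := (entry id).1; rewrite !map_mx_id//; apply.
apply/matrixP => i j; move: (ME i j).
rewrite !mul_diag_mx !mul_mx_diag !mxE => /eqP.
rewrite mulrC -subr_eq0 -mulrBr mulf_eq0 => /orP[/eqP ->|].
  by rewrite mulr0 mul0r.
by rewrite subr_eq0 => /eqP/expR_inj ->; rewrite mulrC.
Qed.

Lemma mlogP n (A : 'M[R]_n) : spd A -> symm (mlog A) /\ mexp (mlog A) = A.
Proof.
move=> /spd_spectral[P [d [PP d0 AE]]]; apply: (@xgetPex _ 0 [set S | symm S /\ mexp S = A]).
exists (P^T *m diag_mx (map_mx (@ln R) d) *m P); split; first exact: symm_conj.
rewrite mexp_spectral// AE; congr (_ *m diag_mx _ *m _).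
by apply/rowP => i; rewrite !mxE lnK// posrE.
Qed.

Lemma mexpK n (S : 'M[R]_n) : symm S -> mlog (mexp S) = S.
Proof. by move=> sS; have [sL /mexp_inj ->] := mlogP (mexp_symm sS). Qed.

Lemma mlog_spectral n (P : 'M[R]_n) (d : 'rV[R]_n) : P *m P^T = 1%:M ->
  (forall i, 0 < d 0 i) ->
  mlog (P^T *m diag_mx d *m P) = P^T *m diag_mx (map_mx (@ln R) d) *m P.
Proof.
move=> PP d0; rewrite -[RHS]mexpK; last exact: symm_conj.
rewrite mexp_spectral//; congr (mlog (_ *m diag_mx _ *m _)).
by apply/rowP => i; rewrite !mxE lnK// posrE.
Qed.

(** In an eigenbasis the two conditions read (e^(d_i) - 1) y_i = 0 and d_i y_i = 0, and e^t = 1 only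
    for t = 0. Applied to the vector of ones, this removes the logarithm from the condition that
    defines [scaling]. *)
Lemma mexp_fixed n (S : 'M[R]_n) (w : 'cV[R]_n) : symm S ->
  mexp S *m w = w <-> S *m w = 0.
Proof.
move=> /symmetric_spectral[P [d [PP ->]]]; rewrite mexp_spectral//.
have PP' := mulmx1C PP; have [y wE] : exists y, w = P^T *m y.
  by exists (P *m w); rewrite mulmxA PP' mul1mx.
have conjE (e : 'rV[R]_n) : P^T *m diag_mx e *m P *m w = P^T *m (diag_mx e *m y).
  by rewrite wE -!mulmxA [P *m _]mulmxA PP mul1mx.
have injP (u v : 'cV[R]_n) : P^T *m u = P^T *m v -> u = v.
  by move/(congr1 (mulmx P)); rewrite !mulmxA PP !mul1mx.
rewrite !conjE [X in _ = X <-> _]wE -(mulmx0 _ P^T); split=> /injP/colP E;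
  congr (_ *m _); apply/colP => i; move: (E i); rewrite !mul_diag_mx !mxE.
  move/eqP; rewrite -subr_eq0 -[X in _ - X]mul1r -mulrBl mulf_eq0 => /orP[|/eqP ->].
    by rewrite subr_eq0 -expR0 => /eqP/expR_inj ->; rewrite mul0r.
  by rewrite mulr0.
move/eqP; rewrite mulf_eq0 => /orP[/eqP ->|/eqP ->]; first by rewrite expR0 mul1r.
by rewrite mulr0.
Qed.

Lemma diagonalP n (A : 'M[R]_n) : diagonal A <-> exists d, A = diag_mx d.
Proof. by split=> [/diag_mxP|[d ->]]; [|exact: diag_mx_is_diag]. Qed.

Lemma mexp_diag n (d : 'rV[R]_n) : mexp (diag_mx d) = diag_mx (map_mx expR d).
Proof.
have := @mexp_spectral n 1%:M d; rewrite trmx1 !mul1mx !mulmx1; exact.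
Qed.

Lemma mlog_diag n (d : 'rV[R]_n) : (forall i, 0 < d 0 i) ->
  mlog (diag_mx d) = diag_mx (map_mx (@ln R) d).
Proof.
have := @mlog_spectral n 1%:M d; rewrite trmx1 !mul1mx !mulmx1; exact.
Qed.

(** The logarithm maps positive diagonal matrices onto all diagonal ones, so in logarithmic
    coordinates the cosets are the translates of the diagonal subspace. *)
Lemma coset_mexp n (S : 'M[R]_n) : symm S ->
  coset (mexp S) = [set mexp (S + diag_mx d) | d in [set: 'rV[R]_n]].
Proof.
move=> sS; rewrite /coset /star mexpK//; apply/seteqP.
split=> [_ [D [/diagonalP[d ->] d0] <-]|_ [d _ <-]].
  exists (map_mx (@ln R) d); first by [].
  by rewrite mlog_diag// => i; have := d0 i; rewrite mxE eqxx mulr1n.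
exists (mexp (diag_mx d)).
  rewrite mexp_diag; split; first by apply/diagonalP; exists (map_mx expR d).
  by move=> i; rewrite !mxE eqxx mulr1n expR_gt0.
by rewrite mexpK// /symm/= tr_diag_mx.
Qed.

Lemma coset_mexpD n (S : 'M[R]_n) (d : 'rV[R]_n) : symm S ->
  coset (mexp (S + diag_mx d)) = coset (mexp S).
Proof.
move=> sS; have sSd : symm (S + diag_mx d) by rewrite /symm/= raddfD/= tr_diag_mx sS.
rewrite !coset_mexp//; apply/seteqP; split => _ [e _ <-].
  by exists (d + e); [|rewrite raddfD/= addrA].
by exists (e - d); [|rewrite raddfB/= [_ - diag_mx d]addrC addrA addrK].
Qed.

Lemma coset_eq_off n (A B : 'M[R]_n) : spd A -> spd B -> coset A = coset B ->
  exists d, mlog A = mlog B + diag_mx d.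
Proof.
move=> /mlogP[sA eA] /mlogP[sB eB]; rewrite -{1}eA -{1}eB !coset_mexp// => AB.
have : [set mexp (mlog A + diag_mx d) | d in [set: 'rV[R]_n]] (mexp (mlog A)).
  by exists 0 => //; rewrite raddf0 addr0.
rewrite AB => -[d _ /mexp_inj e]; exists d; rewrite e//.
by rewrite /symm/= raddfD/= tr_diag_mx sB.
Qed.

End MatrixExpLog.

(** * Smoothness of the logarithm *)

Section Smoothness.
Context {R : realType}.

Lemma is_diff_mx_linear m n (W : normedModType R) (f : 'M[R]_(m, n) -> W) x :
  linear f -> is_diff x f f.
Proof.
move=> lf.
have [L <-] : exists L : {linear 'M[R]_(m, n) -> W}, L = f :> (_ -> _).
  pose Lm := GRing.isLinear.Build _ _ _ _ f lf.
  pose L : {linear 'M[R]_(m, n) -> W} := HB.pack f Lm.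
  by exists L.
have cL := @mx_linear_continuous R m n W L.
by split; [exact: linear_differentiable|exact: diff_lin].
Qed.

Lemma near_eq_differentiable (V W : normedModType R) (f g : V -> W) (x : V) :
  {near x, f =1 g} -> differentiable f x -> differentiable g x.
Proof.
move=> fg df; have [cf fE] := (diff_locallyP _ _).1 df.
have gE : g \o shift x = cst (g x) + 'd f x +o_ 0 id.
  apply/eqaddoP => e e0; move/eqaddoP : fE => /(_ e e0).
  have fg0 : \forall h \near (0 : V), f (h + x) = g (h + x).
    by move: fg; rewrite (near_shift 0) subr0.
  apply: filterS2 fg0 => h fgh.
  have E (u : V -> W) : (u \o shift x - (cst (u x) + 'd f x)) h = u (h + x) - (u x + 'd f x h).
    by [].
  by rewrite !E -(nbhs_singleton fg) fgh.
by apply/diff_locallyP; rewrite (diff_unique cf gE).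
Qed.

(* Stable under directional derivatives: the derivative along v involves the
   series at dblock (A + L x) (e *: L v), where e is small enough to keep the
   row sums below 1. *)
Definition mxps_trace a n (U : set 'M[R]_n) (f : 'M[R]_n -> R) : Prop :=
  exists N (L : 'M[R]_n -> 'M[R]_N) (A C : 'M[R]_N) (b r : R),
  [/\ linear L, 0 < r < 1, forall x, U x -> rowsums_le r (A + L x) &
      forall x, U x -> f x = b + \tr (C *m mxps a (A + L x))].

Lemma dblock_linear n N (L : 'M[R]_n -> 'M[R]_N) : linear L ->
  linear (fun x => dblock (L x) 0).
Proof.
move=> lL c x y; rewrite /dblock lL scale_block_mx add_block_mx.
by rewrite !scaler0 !addr0.
Qed.

Lemma rowsums_dblock n r w (X V : 'M[R]_n) : 0 <= w ->
  rowsums_le r X -> rowsums_le w V -> rowsums_le (r + w) (dblock X V).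
Proof.
move=> w0 Xr Vw i; rewrite big_split_ord /=.
case: (split_ordP i) => k ->.
  under eq_bigr do rewrite block_mxEul.
  by under [X in _ + X]eq_bigr do rewrite block_mxEur; apply: lerD.
under eq_bigr do rewrite block_mxEdl mxE normr0.
under [X in _ + X]eq_bigr do rewrite block_mxEdr.
by rewrite big1// add0r; apply: le_trans (Xr k) _; rewrite lerDl.
Qed.

Lemma dmxpsZ a r n (X V : 'M[R]_n) c : 0 < r -> summable2 a r -> rowsums_le r X ->
  dmxps a X (c *: V) = c *: dmxps a X V.
Proof.
move=> r0 ar Xr; have lD := dmxps_linear r0 ar Xr.
have D0 : dmxps a X 0 = 0.
  by have := lD (-1) 0 0; rewrite scaler0 addr0 scaleN1r addNr.
by have := lD c V 0; rewrite addr0 D0 addr0.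
Qed.

(** The derivative along v is the trace of C against [dmxps], the upper right block of a series of
    size 2 N; a trace against a suitable block matrix extracts it, so the derivative has the same
    form as f. *)
Lemma mxps_trace_derive a n (U : set 'M[R]_n) f :
  (forall r, 0 < r < 1 -> summable2 a r) -> open U -> mxps_trace a U f ->
  (forall x, U x -> differentiable f x) /\ forall v, mxps_trace a U (fun x => 'D_v f x).
Proof.
move=> sa oU [N [L [A [C [b [r [lL r01 Ar fE]]]]]]].
have /andP[r0 r1] := r01.
pose r' := (r + 1) / 2.
have rr' : r < r' by rewrite midf_lt.
have r'1 : r' < 1 by rewrite midf_lt.
have ar' : summable2 a r' by apply: sa; rewrite (lt_trans r0).
have ar : summable2 a r by apply: sa; rewrite r0.
pose phi x := b + \tr (C *m mxps a (A + L x)).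
have dphi x : U x -> is_diff x phi (fun v => \tr (C *m dmxps a (A + L x) (L v))).
  move=> Ux.
  have d1 : is_diff x (fun y => A + L y) L.
    have dL := is_diff_mx_linear x lL.
    have := is_diffD (is_diff_cst A x) dL.
    by rewrite add0r.
  have d2 := is_diff_mxps r0 rr' ar' (Ar x Ux).
  have lt : linear (fun Y : 'M[R]_N => \tr (C *m Y) : R).
    by move=> c Y Z; rewrite mulmxDr -scalemxAr mxtraceD mxtraceZ.
  have d3 : is_diff (mxps a (A + L x)) (fun Y : 'M[R]_N => b + \tr (C *m Y))
      (fun Y => \tr (C *m Y)).
    have dt := is_diff_mx_linear (mxps a (A + L x)) lt.
    have := is_diffD (is_diff_cst b (mxps a (A + L x))) dt.
    by rewrite add0r.
  have d12 := is_diff_comp d1 d2.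
  exact: is_diff_comp d12 d3.
have near_phi x : U x -> {near x, phi =1 f}.
  by move=> Ux; apply: filterS (open_nbhs_nbhs (conj oU Ux)) => y /fE.
split=> [x Ux|v].
  by apply: near_eq_differentiable (near_phi x Ux) _; have [] := dphi x Ux.
(* [L v] may be large. Since [dmxps] is linear in its direction, shrinking [L v] by e is undone by a
   factor e^-1, while the row sums grow by at most (1 - r) / 2, from r to r'. *)
have [e [e0 ev]] : exists e : R, 0 < e /\ rowsums_le ((1 - r) / 2) (e *: L v).
  exists ((1 - r) / 2 / (N%:R * `|L v| + 1)).
  have p0 : 0 < (1 - r) / 2 / (N%:R * `|L v| + 1).
    by rewrite !divr_gt0 ?subr_gt0 ?ltr_wpDl ?mulr_ge0.
  split=> //; apply: rowsums_leW (rowsumsZ _ (@rowsums_norm _ _ (L v))).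
  rewrite gtr0_norm// mulrAC ler_pdivrMr ?ltr_wpDl ?mulr_ge0//.
  by rewrite ler_wpM2l ?lerDl// divr_ge0// subr_ge0 ltW.
(* Placing e^-1 C in the lower left block makes the trace pick out the upper right block of the
   series. *)
exists (N + N)%N, (fun x => dblock (L x) 0), (dblock A (e *: L v)),
  (block_mx 0 0 (e^-1 *: C) 0), 0, r'.
split.
- exact: dblock_linear.
- by rewrite (lt_trans r0 rr').
- move=> x Ux; rewrite /dblock add_block_mx !addr0 -/(dblock _ _).
  rewrite (_ : r' = r + (1 - r) / 2); last by rewrite /r'; field.
  by apply: rowsums_dblock => //; [rewrite divr_ge0// subr_ge0 ltW|exact: Ar].
move=> x Ux; rewrite add0r.
have -> : 'D_v f x = \tr (C *m dmxps a (A + L x) (L v)).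
  rewrite -(near_eq_derive v (near_phi x Ux)).
  have [df dE] := dphi x Ux; by rewrite deriveE// dE.
rewrite /dblock add_block_mx !addr0 -/(dblock _ _).
rewrite -[mxps a (dblock _ _)]submxK mulmx_block mxtrace_block.
rewrite !mul0mx !addr0 mxtrace0 add0r -scalemxAl -/(dmxps a _ _).
by rewrite (dmxpsZ _ _ r0 ar (Ar x Ux)) -scalemxAr scalerA mulVf ?gt_eqF// scale1r.
Qed.

Lemma mxps_trace_Ck a n (U : set 'M[R]_n) f k :
  (forall r, 0 < r < 1 -> summable2 a r) -> open U -> mxps_trace a U f -> Ck k U f.
Proof.
move=> sa oU; elim: k f => [|k IH] f /(mxps_trace_derive sa oU)[df Df] /=.
  by move=> x /df /differentiable_continuous.
by split=> // v; exact/IH/Df.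
Qed.

End Smoothness.

Section SmoothLog.
Context {R : realType}.

(** The inverse of 1 plus the sum of the inverses is a lower bound that exists even for an empty
    index type, where there is no minimum. *)
Lemma pos_lower_bound (I : finType) (d : I -> R) : (forall i, 0 < d i) ->
  exists2 m : R, 0 < m & forall i, m <= d i.
Proof.
move=> d0; have s0 : 0 < 1 + \sum_i (d i)^-1.
  by rewrite ltr_pwDl// sumr_ge0// => i _; rewrite invr_ge0 ltW.
exists (1 + \sum_i (d i)^-1)^-1; first by rewrite invr_gt0.
move=> i; rewrite -[leRHS]invrK lef_pV2 ?posrE ?invr_gt0//.
rewrite (bigD1 i)//= addrCA lerDl addr_ge0// sumr_ge0// => j _.
by rewrite invr_ge0 ltW.
Qed.

Lemma rowsums_mulmx n r (X : 'M[R]_n) (v : 'cV[R]_n) : 0 <= r ->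
  rowsums_le r X -> `|X *m v| <= r * `|v|.
Proof.
move=> r0 Xr; apply: mx_norm_le => [|i j]; first by rewrite mulr_ge0.
rewrite mxE; apply: le_trans (ler_norm_sum _ _ _) _.
apply: (@le_trans _ _ (\sum_k `|X i k| * `|v|)).
  by apply: ler_sum => k _; rewrite normrM ler_wpM2l// ler_mx_entry.
by rewrite -mulr_suml ler_wpM2r.
Qed.

(** An operator norm bounds every eigenvalue: apply the matrix to an eigenvector. This puts the
    eigenvalues in the disc where the scalar logarithmic series converges. *)
Lemma rowsums_spectral n r (P : 'M[R]_n) (d : 'rV[R]_n) i : 0 <= r ->
  P *m P^T = 1%:M -> rowsums_le r (P^T *m diag_mx d *m P) -> `|d 0 i| <= r.
Proof.
move=> r0 PP Xr; pose v : 'cV[R]_n := P^T *m delta_mx i 0.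
have v0 : v != 0.
  apply/eqP => v0; have : P *m v = delta_mx i 0 by rewrite mulmxA PP mul1mx.
  by rewrite v0 mulmx0 => /matrixP/(_ i 0)/eqP; rewrite !mxE !eqxx eq_sym oner_eq0.
have Xv : P^T *m diag_mx d *m P *m v = d 0 i *: v.
  rewrite /v -!mulmxA (mulmxA P) PP mul1mx scalemxAr; congr (_ *m _).
  apply/colP => k; rewrite mul_diag_mx !mxE.
  by case: eqVneq => [->|_]; rewrite ?mulr0.
have := rowsums_mulmx v r0 Xr; rewrite Xv normrZ ler_pM2r//.
by rewrite normr_gt0.
Qed.

Lemma rowsums_diag n r (d : 'rV[R]_n) : (forall i, `|d 0 i| <= r) ->
  rowsums_le r (diag_mx d).
Proof.
move=> dr i; rewrite (bigD1 i)//= big1 => [|j ji].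
  by rewrite mxE eqxx mulr1n addr0.
by rewrite mxE eq_sym (negbTE ji) mulr0n normr0.
Qed.

(* log A = (ln c) I - P^T (\sum_k (I - P A P^T / c)^k / k) P, where P is
   orthogonal. *)
Lemma mlog_series n (P A : 'M[R]_n) (c r : R) : P *m P^T = 1%:M -> 0 < c ->
  0 < r < 1 -> spd A -> rowsums_le r (1%:M - c^-1 *: (P *m A *m P^T)) ->
  mlog A = (ln c)%:M - P^T *m mxps log_coef (1%:M - c^-1 *: (P *m A *m P^T)) *m P.
Proof.
move=> PP c0 /andP[r0 r1] /spd_spectral[Q [m [QQ m0 ->]]].
have PP' := mulmx1C PP; have QQ' := mulmx1C QQ.
(* [S] diagonalises the argument of the series, and the entries of [d] are its eigenvalues; the
   eigenvectors of A itself need not be those in P. *)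
pose S := Q *m P^T; pose d : 'rV[R]_n := \row_i (1 - m 0 i / c).
have SS : S *m S^T = 1%:M.
  by rewrite trmx_mul trmxK mulmxA -(mulmxA Q) PP' mulmx1.
have -> : 1%:M - c^-1 *: (P *m (Q^T *m diag_mx m *m Q) *m P^T) =
    S^T *m diag_mx d *m S.
  have -> : diag_mx d = 1%:M - c^-1 *: diag_mx m.
    apply/matrixP => i j; rewrite !mxE; case: (i == j); rewrite ?mulr1n ?mulr0n.
      by rewrite mulrC.
    by rewrite mulr0 subr0.
  rewrite mulmxBr mulmxBl mulmx1 (mulmx1C SS) -scalemxAr -scalemxAl; congr (_ - _ *: _).
  by rewrite /S trmx_mul trmxK !mulmxA.
move=> Xr; rewrite mlog_spectral//.
rewrite (mxps_spectral (f := fun x => - ln (1 - x)))//; last first.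
  move=> i; apply: cvg_log_series; apply: le_lt_trans r1.
  exact: rowsums_spectral (ltW r0) SS Xr.
have -> : P^T *m (S^T *m diag_mx (map_mx (fun x : R => - ln (1 - x)) d) *m S) *m P =
    Q^T *m diag_mx (map_mx (fun x : R => - ln (1 - x)) d) *m Q.
  rewrite /S trmx_mul trmxK !mulmxA PP' mul1mx -(mulmxA _ P^T) PP' mulmx1.
  by [].
have -> : (ln c)%:M = Q^T *m diag_mx (const_mx (ln c)) *m Q.
  by rewrite diag_const_mx mul_mx_scalar -scalemxAl QQ' scalemx1.
rewrite -mulmxBl -mulmxBr -raddfB; congr (_ *m diag_mx _ *m _).
apply/rowP => i; rewrite !mxE opprK opprB [1 + _]addrC subrK.
by rewrite -lnM ?posrE ?divr_gt0// mulrC divfK ?gt_eqF.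
Qed.

Lemma mxtrace_mul_delta m n (X : 'M[R]_(m, n)) i j : \tr (X *m delta_mx j i) = X i j.
Proof.
rewrite /mxtrace (bigD1 i)//= big1 ?addr0 => [|k ki]; rewrite mxE (bigD1 j)//= big1.
- by rewrite !mxE !eqxx mulr1 addr0.
- by move=> l lj; rewrite !mxE (negbTE lj) mulr0.
- by rewrite !mxE (negbTE ki) andbF mulr0 addr0.
- by move=> l lj; rewrite !mxE (negbTE lj) mulr0.
Qed.

(** Row sums depend on the basis. Conjugating by the eigenvectors of A0 makes the argument of the
    series diagonal at A0, where its row sums are just 1 - d_k / c; nearby matrices keep the same P
    and c. *)
Lemma smooth_mlog n (i j : 'I_n) : smooth_on spd (fun A : 'M[R]_n => mlog A i j).
Proof.
move=> A0 /spd_spectral[P [d [PP d0 A0E]]].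
have [m m0 md] := pos_lower_bound d0.
(* Any upper bound of the eigenvalues would do; adding m keeps c positive even when n = 0. *)
pose c := m + \sum_i d 0 i.
have c0 : 0 < c by rewrite ltr_pwDl// sumr_ge0// => k _; rewrite ltW.
have mc : m <= c by rewrite lerDl sumr_ge0// => k _; rewrite ltW.
have dc k : d 0 k <= c.
  rewrite /c (bigD1 k)//= addrCA lerDl addr_ge0 ?(ltW m0)// sumr_ge0// => l _.
  by rewrite ltW.
(* [r0] bounds the row sums at A0; [r] gives half of the gap m / c to the neighbours of A0 and stays
   below 1. *)
pose r0 := 1 - m / c; pose r := 1 - m / c / 2.
have mc0 : 0 < m / c by rewrite divr_gt0.
have mc1 : m / c <= 1 by rewrite ler_pdivrMr ?mul1r.
have r01 : 0 < r < 1 by rewrite /r; apply/andP; split; lra.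
pose L (x : 'M[R]_n) := - c^-1 *: (P *m x *m P^T).
have lL : linear L.
  move=> k x y; rewrite /L mulmxDr mulmxDl -scalemxAr -scalemxAl scalerDr.
  by rewrite !scalerA mulrC.
have A0r0 : rowsums_le r0 (1%:M + L A0).
  rewrite /L A0E !mulmxA PP mul1mx -mulmxA PP mulmx1.
  have -> : 1%:M + - c^-1 *: diag_mx d = diag_mx (\row_i (1 - d 0 i / c)).
    apply/matrixP => k l; rewrite !mxE; case: (k == l); rewrite ?mulr1n ?mulr0n.
      by rewrite mulrC mulrN.
    by rewrite mulr0 addr0.
  apply: rowsums_diag => k; rewrite mxE ger0_norm.
    by rewrite lerD2l lerN2 ler_wpM2r ?invr_ge0 ?(ltW c0).
  by rewrite subr_ge0 ler_pdivrMr ?mul1r.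
have nL : \forall x \near A0, rowsums_le r (1%:M + L x).
  have dL := is_diff_mx_linear A0 lL.
  have /differentiable_continuous cL := ex_diff (is_diff_def := dL).
  have e0 : 0 < m / c / 2 / n.+1%:R by rewrite !divr_gt0.
  have nb : \forall x \near A0, `|L A0 - L x| <= m / c / 2 / n.+1%:R.
    exact: (cvgrPdist_le _ _).1 cL _ e0.
  apply: filterS nb => x Lx.
  have -> : 1%:M + L x = (1%:M + L A0) - (L A0 - L x) by rewrite opprB addrACA subrr addr0.
  have -> : r = r0 + m / c / 2 by rewrite /r /r0; field; rewrite gt_eqF.
  apply: rowsumsD A0r0 _; rewrite -[- _]scaleN1r.
  apply: rowsums_leW (rowsumsZ _ (@rowsums_norm _ _ _)).
  rewrite normrN1 mul1r; apply: (@le_trans _ _ (n.+1%:R * `|L A0 - L x|)).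
    by rewrite ler_wpM2r// ler_nat.
  by rewrite mulrC -ler_pdivlMr.
(* The (i, j) entry is a trace against [delta_mx j i]; moving P and P^T around the trace conjugates
   this elementary matrix and leaves the form required by [mxps_trace]. *)
pose F x := (if i == j then ln c else 0) +
  \tr ((- (P *m delta_mx j i *m P^T)) *m mxps log_coef (1%:M + L x)).
exists [set x | rowsums_le r (1%:M + L x)]°, F; split.
- exact: open_interior.
- exact: nL.
- move=> k; apply: (mxps_trace_Ck (a := log_coef)).
  + exact: summable2_log.
  + exact: open_interior.
  exists n, L, 1%:M, (- (P *m delta_mx j i *m P^T)), (if i == j then ln c else 0), r.
  by split=> // x /interior_subset.
move=> x /interior_subset xr sx.
have E : 1%:M + L x = 1%:M - c^-1 *: (P *m x *m P^T) by rewrite /L scaleNr.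
rewrite (mlog_series PP c0 r01 sx) -?E// /F.
move: (mxps _ _) => M.
rewrite [RHS]mxE [X in _ = X + _]mxE [X in _ = _ + X]mxE.
congr (_ + _); first by case: (i == j); rewrite ?mulr1n ?mulr0n.
rewrite mulNmx raddfN /=; congr (- _).
by rewrite -[_ *m P^T *m M]mulmxA mxtrace_mulC [_ *m (P *m _)]mulmxA mxtrace_mul_delta.
Qed.

End SmoothLog.

(** * Scaling to unit row sums *)

Section Coercivity.
Context {R : realType} {n : nat}.
Implicit Types (A E M : 'M[R]_n) (x y : 'cV[R]_n) (c : R).

Definition coercive c M := forall x, c * \sum_i x i 0 ^+ 2 <= (x^T *m M *m x) 0 0.

Lemma quadE M x : (x^T *m M *m x) 0 0 = \sum_i x i 0 * (M *m x) i 0.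
Proof. by rewrite -mulmxA mxE; apply: eq_bigr => i _; rewrite mxE. Qed.

Lemma spd_coercive A : spd A -> exists2 c, 0 < c & coercive c A.
Proof.
move=> /spd_spectral[P [d [PP d0 ->]]].
have [m m0 md] := pos_lower_bound d0; exists m => // x.
have -> : \sum_i x i 0 ^+ 2 = \sum_i (P *m x) i 0 ^+ 2.
  have sqE (z : 'cV[R]_n) : \sum_i z i 0 ^+ 2 = (z^T *m z) 0 0.
    by rewrite mxE; apply: eq_bigr => i _; rewrite mxE.
  by rewrite !sqE trmx_mul mulmxA -(mulmxA _ P^T) (mulmx1C PP) mulmx1.
by rewrite quad_conj mulr_sumr ler_sum// => i _; rewrite ler_wpM2r ?sqr_ge0.
Qed.

Lemma coercive_spd c A : 0 < c -> symm A -> coercive c A -> spd A.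
Proof.
move=> c0 sA cA; split=> // x x0; apply: lt_le_trans (cA x).
rewrite mulr_gt0// lt_neqAle sumr_ge0 ?andbT => [|i _]; last exact: sqr_ge0.
apply: contra x0; rewrite eq_sym psumr_eq0 => [/allP x0|i _]; last exact: sqr_ge0.
apply/eqP/colP => i; have := x0 i (mem_index_enum i).
by rewrite sqrf_eq0 mxE => /eqP.
Qed.

(** Summing |x_i x_j| <= (x_i^2 + x_j^2) / 2 over all pairs gives the factor n. *)
Lemma quad_norm E x : `|(x^T *m E *m x) 0 0| <= n%:R * `|E| * \sum_i x i 0 ^+ 2.
Proof.
have -> : n%:R * `|E| * \sum_i x i 0 ^+ 2 =
    \sum_i \sum_j `|E| * ((x i 0 ^+ 2 + x j 0 ^+ 2) / 2).
  rewrite [RHS](eq_bigr (fun i => `|E| / 2 * (n%:R * x i 0 ^+ 2 + \sum_j x j 0 ^+ 2))).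
    rewrite -mulr_sumr big_split/= -mulr_sumr sumr_const card_ord.
    by rewrite -[_ *+ n]mulr_natl; field.
  move=> i _; rewrite -mulr_sumr -mulr_suml big_split/= sumr_const card_ord.
  by rewrite -[_ *+ n]mulr_natl; field.
rewrite quadE; apply: le_trans (ler_norm_sum _ _ _) _; apply: ler_sum => i _.
rewrite mxE mulr_sumr; apply: le_trans (ler_norm_sum _ _ _) _; apply: ler_sum => j _.
rewrite mulrCA normrM; apply: ler_pM => //; first exact: ler_mx_entry.
rewrite ler_pdivlMr// normrM -subr_ge0 -[x i 0 ^+ 2]real_normK ?num_real//.
rewrite -[x j 0 ^+ 2]real_normK ?num_real//.
rewrite (_ : _ - _ = (`|x i 0| - `|x j 0|) ^+ 2) ?sqr_ge0//; ring.
Qed.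

Lemma coerciveD c A E : coercive c A -> coercive (c - n%:R * `|E|) (A + E).
Proof.
move=> cA x; rewrite mulmxDr mulmxDl mxE mulrBl lerD//.
by rewrite lerNl; apply: le_trans (quad_norm E x); rewrite -normrN ler_norm.
Qed.

Lemma coercive_diag c A (d : 'rV[R]_n) : (forall i, 0 <= d 0 i) -> coercive c A ->
  coercive c (A + diag_mx d).
Proof.
move=> d0 cA x; rewrite mulmxDr mulmxDl mxE -[leLHS]addr0 lerD// quadE sumr_ge0// => i _.
by rewrite mul_diag_mx mxE mulrCA -expr2 mulr_ge0 ?sqr_ge0.
Qed.

(** c |x|^2 <= c sum x_i^2 <= x^T M x <= n |x| |M x|. The resulting bound on the inverse depends on
    M only through c, which makes it uniform over a neighbourhood. *)
Lemma coercive_norm c M x : 0 < c -> coercive c M -> `|x| <= n%:R / c * `|M *m x|.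
Proof.
move=> c0 cM; have [->|x0] := eqVneq x 0; first by rewrite normr0 !mulr_ge0 ?invr_ge0 ?(ltW c0).
have nx : 0 < `|x| by rewrite normr_gt0.
rewrite mulrAC ler_pdivlMr// -(ler_pM2r nx).
apply: (@le_trans _ _ (c * \sum_i x i 0 ^+ 2)).
  have [[i j] xij] : exists ij : 'I_n * 'I_1, `|x| = `|x ij.1 ij.2|.
    by apply: mx_norm_neq0; rewrite gt_eqF.
  rewrite mulrAC mulrC ler_wpM2l ?(ltW c0)// xij -expr2 real_normK ?num_real// ord1.
  by rewrite (bigD1 i)//= lerDl sumr_ge0// => k _; rewrite sqr_ge0.
apply: le_trans (cM x) _; rewrite quadE; apply: (@le_trans _ _ (\sum_(i < n) `|x| * `|M *m x|)).
  apply: ler_sum => i _; apply: le_trans (ler_norm _) _; rewrite normrM.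
  by apply: ler_pM => //; exact: ler_mx_entry.
by rewrite sumr_const card_ord -[leLHS]mulr_natl mulrCA mulrC.
Qed.

Lemma coercive_unit c M : 0 < c -> coercive c M -> M \in unitmx.
Proof.
move=> c0 cM; rewrite -unitmx_tr -row_free_unit -kermx_eq0.
apply/rowV0P => v /sub_kermxP vM.
have := coercive_norm v^T c0 cM.
have -> : M *m v^T = 0 by rewrite -[LHS]trmxK trmx_mul trmxK vM trmx0.
by rewrite normr0 mulr0 normr_le0 => /eqP/(congr1 trmx); rewrite trmxK trmx0.
Qed.

(** Half of the coercivity constant of A survives in a ball. The ball also contains non-symmetric
    matrices, hence [coercive] in place of [spd]. *)
Lemma near_coercive A : spd A -> exists2 c, 0 < c & \forall B \near A, coercive c B.
Proof.
move=> /spd_coercive[c c0 cA]; exists (c / 2); first by rewrite divr_gt0.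
have e0 : 0 < c / 2 / n.+1%:R by rewrite !divr_gt0.
have nb : \forall B \near A, `|A - B| <= c / 2 / n.+1%:R.
  exact: (cvgrPdist_le _ _).1 (@cvg_id _ (nbhs A)) _ e0.
apply: filterS nb => B AB x; rewrite -[B](subrK A) addrC.
apply: le_trans (coerciveD (B - A) cA x).
rewrite ler_wpM2r ?sumr_ge0// => [i _|]; first exact: sqr_ge0.
rewrite lerBrDl -lerBrDr (_ : c - c / 2 = c / 2); last by field.
apply: (@le_trans _ _ (n.+1%:R * `|A - B|)).
  by rewrite distrC ler_wpM2r// ler_nat.
by rewrite mulrC -ler_pdivlMr.
Qed.

Lemma near_spd A : spd A -> \forall B \near A, symm B -> spd B.
Proof.
move=> /near_coercive[c c0]; apply: filterS => B cB sB.
exact: coercive_spd c0 sB cB.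
Qed.

End Coercivity.

(** * Existence and uniqueness of the scaling vector *)

Section Scaling.
Context {R : realType} {n : nat}.
Implicit Types (A C : 'M[R]_n) (d : 'cV[R]_n).

Definition scales C d := (forall i, 0 < d i 0) /\ forall i, d i 0 * (C *m d) i 0 = 1.

(* C d = 1 / d is a monotone equation in d. *)
Lemma scales_inj C d e : spd C -> scales C d -> scales C e -> d = e.
Proof.
move=> /spd_coercive[c c0 cC] [d0 dC] [e0 eC].
have E i : (d - e) i 0 * (C *m (d - e)) i 0 = - ((d - e) i 0 ^+ 2 / (d i 0 * e i 0)).
  have di : (C *m d) i 0 = (d i 0)^-1.
    by apply: (mulfI (lt0r_neq0 (d0 i))); rewrite dC divff ?gt_eqF.
  have ei : (C *m e) i 0 = (e i 0)^-1.
    by apply: (mulfI (lt0r_neq0 (e0 i))); rewrite eC divff ?gt_eqF.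
  rewrite mulmxBr [X in _ * X]mxE [X in _ * (_ + X)]mxE di ei [X in X * _]mxE [X in X ^+ 2]mxE.
  rewrite [X in _ + X]mxE.
  by field; rewrite !gt_eqF.
have := cC (d - e); rewrite quadE (eq_bigr _ (fun i _ => E i)) sumrN => H.
have S0 : 0 <= \sum_i (d - e) i 0 ^+ 2 by apply: sumr_ge0 => i _; exact: sqr_ge0.
have T0 : 0 <= \sum_i (d - e) i 0 ^+ 2 / (d i 0 * e i 0).
  by apply: sumr_ge0 => i _; rewrite divr_ge0 ?sqr_ge0// mulr_ge0// ltW.
have : \sum_i (d - e) i 0 ^+ 2 = 0.
  apply/eqP; rewrite eq_le S0 andbT -(pmulr_rle0 _ c0).
  by apply: le_trans H _; rewrite oppr_le0.
move/eqP; rewrite psumr_eq0 => [/allP de|i _]; last exact: sqr_ge0.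
apply/eqP; rewrite -subr_eq0; apply/eqP/colP => i.
by have := de i (mem_index_enum i); rewrite sqrf_eq0 [RHS]mxE => /eqP.
Qed.

(* In the coordinates d = exp y, scales C d says that the gradient vanishes. *)
Definition potential C (y : 'rV[R]_n) : R :=
  2^-1 * \sum_i \sum_j C i j * (expR (y 0 i) * expR (y 0 j)) - \sum_i y 0 i.

Lemma continuous_potential C : continuous (potential C).
Proof.
move=> y; have FY : Filter (nbhs y) := nbhs_filter y.
have cy i : (fun z : 'rV[R]_n => expR (z 0 i)) @ y --> expR (y 0 i).
  have h : (fun z : 'rV[R]_n => z 0 i) @ y --> y 0 i := @coord_continuous R 1 n 0 i y.
  exact: cvg_comp h (@continuous_expR R (y 0 i)).
apply: (@cvgB _ _ _ (nbhs y)); last first.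
  by apply: (@cvg_sumr _ _ _ _ (nbhs y)) => i; exact: coord_continuous.
apply: (@cvgM _ _ (nbhs y)); first exact: cvg_cst.
apply: (@cvg_sumr _ _ _ _ (nbhs y)) => i; apply: (@cvg_sumr _ _ _ _ (nbhs y)) => j.
by apply: (@cvgM _ _ (nbhs y)); [exact: cvg_cst|exact: (@cvgM _ _ (nbhs y))].
Qed.

(** Coercivity of C bounds the coupled potential below by a sum of functions of one variable, which
    can be controlled coordinate by coordinate. *)
Lemma potential_coercive C c (y : 'rV[R]_n) : 0 < c -> coercive c C ->
  \sum_i (c / 2 * expR (y 0 i) ^+ 2 - y 0 i) <= potential C y.
Proof.
move=> c0 cC; rewrite sumrB lerD2r -mulr_sumr.
have := cC (\col_i expR (y 0 i)); rewrite quadE => H.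
rewrite [c / 2]mulrC -mulrA ler_wpM2l ?invr_ge0//.
apply: le_trans (le_trans _ H) _.
  by rewrite ler_wpM2l ?(ltW c0)//; apply: ler_sum => i _; rewrite mxE.
apply: ler_sum => i _; rewrite !mxE mulr_sumr; apply: ler_sum => j _.
by rewrite mxE mulrCA.
Qed.

Lemma exp_barrier_bounded c B : 0 < c -> 0 < B -> exists2 M : R, 0 < M &
  forall y, c / 2 * expR y ^+ 2 - y <= B -> `|y| < M.
Proof.
(* For y <= -M the term -y alone exceeds B. For y >= M, e^y >= y and c y / 2 >= B + 2 make the
   barrier at least (B + 1) y > B. *)
move=> c0 B0; exists (B + 2 + 2 * (B + 2) / c).
  by rewrite addr_gt0 ?addr_gt0// divr_gt0// mulr_gt0// addr_gt0.
set M := _ + _ => y yB; have M1 : B + 2 <= M.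
  by rewrite lerDl divr_ge0 ?(ltW c0)// mulr_ge0// addr_ge0// ltW.
have M2 : 2 * (B + 2) / c <= M by rewrite lerDr addr_ge0// ltW.
rewrite ltr_norml; apply/andP; split.
  have : 0 <= c / 2 * expR y ^+ 2 by rewrite mulr_ge0 ?sqr_ge0// divr_ge0// ltW.
  move: yB; lra.
rewrite ltNge; apply/negP => My.
have y2 : B + 2 <= c / 2 * y.
  move: (le_trans M2 My); rewrite ler_pdivrMr// => ?; lra.
have y1 : B + 2 <= y := le_trans M1 My.
have ey : y ^+ 2 <= expR y ^+ 2.
  rewrite ler_sqr ?nnegrE ?expR_ge0//; last by move: y1 B0; lra.
  by apply: le_trans (expR_ge1Dx y); rewrite lerDr.
have : c / 2 * y ^+ 2 <= c / 2 * expR y ^+ 2.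
  by rewrite ler_wpM2l// divr_ge0// ltW.
rewrite expr2 mulrA => H.
have : (B + 2) * y <= c / 2 * y * y by rewrite ler_wpM2r//; move: y1 B0; lra.
nra.
Qed.

(** Replace y by the larger e^y and complete the square around e^y = 1/c. *)
Lemma exp_barrier_ge c (y : R) : 0 < c -> - (2 * c)^-1 <= c / 2 * expR y ^+ 2 - y.
Proof.
move=> c0; have E0 := expR_gt0 y.
have yE : y <= expR y by apply: le_trans (expR_ge1Dx y); rewrite lerDr.
have : 0 <= c / 2 * (expR y - c^-1) ^+ 2 by rewrite mulr_ge0 ?sqr_ge0// divr_ge0// ltW.
have -> : c / 2 * (expR y - c^-1) ^+ 2 = c / 2 * expR y ^+ 2 - expR y + (2 * c)^-1.
  by field; rewrite gt_eqF.
lra.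
Qed.

(** A point no higher than 0 lies in the cube of side 2 M: bounding the other barriers below
    isolates one coordinate. The minimum over this compact cube, which contains 0, is thus
    global. *)
Lemma potential_min C : spd C -> exists y, forall z, potential C y <= potential C z.
Proof.
move=> sC; have [c c0 cC] := spd_coercive sC.
(* n k pays for the lower bounds -k of the other coordinates, and the final 1 makes B positive. *)
pose k := (2 * c)^-1; pose B := `|potential C 0| + n%:R * k + 1.
have k0 : 0 < k by rewrite invr_gt0 mulr_gt0.
have B0 : 0 < B by rewrite ltr_wpDl// addr_ge0// mulr_ge0// ltW.
have [M M0 MB] := exp_barrier_bounded c0 B0.
have small y : potential C y <= potential C 0 -> forall i, `|y 0 i| <= M.
  move=> y0 i; apply/ltW/MB.
  have := le_trans (potential_coercive y c0 cC) y0; rewrite (bigD1 i)//= => H.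
  have S : - (n%:R * k) <= \sum_(j | j != i) (c / 2 * expR (y 0 j) ^+ 2 - y 0 j).
    apply: (@le_trans _ _ (\sum_(j | j != i) - k)).
      rewrite sumrN lerN2 sumr_const -[leLHS]mulr_natl ler_wpM2r ?(ltW k0)// ler_nat.
      by rewrite -[X in (_ <= X)%N]card_ord max_card.
    by apply: ler_sum => j _; exact: exp_barrier_ge.
  have := ler_norm (potential C 0); rewrite /B; move: H S; lra.
pose K := [set y : 'rV[R]_n | forall i, `[- M, M]%classic (y 0 i)].
have cK : compact K.
  by apply: (@rV_compact _ n (fun=> `[- M, M]%classic)) => _; exact: segment_compact.
have K0 : K 0 by move=> i; rewrite /= mxE in_itv/=; apply/andP; split; lra.
have [] := @EVT_min_rV R n (potential C) K _ cK.
- by exists 0.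
- exact: continuous_subspaceT (@continuous_potential C).
move=> y /set_mem Ky miny; exists y => z.
have [zK|zK] := leP (potential C z) (potential C 0); last first.
  by apply: le_trans (ltW zK); apply: miny; rewrite inE.
apply: miny; rewrite inE => i /=; rewrite in_itv/=.
by have := small z zK i; rewrite ler_norml.
Qed.

Lemma quad_delta C (x : 'cV[R]_n) i (t : R) : symm C ->
  (x + t *: delta_mx i 0)^T *m C *m (x + t *: delta_mx i 0) =
  x^T *m C *m x + (2 * t * (C *m x) i 0 + t ^+ 2 * C i i)%:M.
Proof.
move=> sC; rewrite [(x + _)^T]linearD/= linearZ/= !mulmxDl !mulmxDr.
have e1 : (delta_mx i 0)^T *m C *m x = ((C *m x) i 0)%:M :> 'M_1.
  by rewrite trmx_delta -rowE [LHS]mx11_scalar -row_mul mxE.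
have e2 : x^T *m C *m delta_mx i 0 = ((C *m x) i 0)%:M :> 'M_1.
  have : (x^T *m C *m delta_mx i 0)^T = ((C *m x) i 0)%:M :> 'M_1.
    by rewrite !trmx_mul trmxK mulmxA sC e1.
  by move/(congr1 trmx); rewrite trmxK tr_scalar_mx.
have e3 : (delta_mx i 0)^T *m C *m delta_mx i 0 = (C i i)%:M :> 'M_1.
  by rewrite trmx_delta -rowE -colE [LHS]mx11_scalar !mxE.
rewrite -!scalemxAl -!scalemxAr e1 e2 e3 -addrA; congr (_ + _).
by apply/matrixP => a b; rewrite !ord1 !mxE; ring.
Qed.

(** At a minimum of the potential each partial derivative vanishes, and the i-th one is d_i (C d)_i
    - 1 for d = exp y. *)
Lemma scales_exists C : spd C -> exists d, scales C d.
Proof.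
move=> sC; have [y miny] := potential_min sC.
pose d : 'cV[R]_n := \col_i expR (y 0 i).
exists d; split=> i; first by rewrite mxE expR_gt0.
pose a := d i 0 * (C *m d) i 0; pose b := d i 0 ^+ 2 * C i i / 2.
have potE z : potential C z = 2^-1 * ((\col_i expR (z 0 i))^T *m C *m (\col_i expR (z 0 i)) ) 0 0
    - \sum_i z 0 i.
  rewrite /potential quadE; congr (_ * _ - _); apply: eq_bigr => p _.
  by rewrite !mxE mulr_sumr; apply: eq_bigr => q _; rewrite !mxE mulrCA.
(* Moving y_i by t multiplies d_i by e^t, so [psi] is exactly the increment of the potential, and
   one-variable calculus applies. *)
pose psi (t : R) := (expR t - 1) * a + (expR t - 1) ^+ 2 * b - t.
have psi0 t : psi 0 <= psi t.
  have := miny (y + t *: delta_mx 0 i); rewrite !potE.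
  have -> : \col_j expR ((y + t *: delta_mx 0 i) 0 j) =
      d + ((expR t - 1) * d i 0) *: delta_mx i 0.
    apply/colP => j; rewrite !mxE eqxx /=; case: eqVneq => [->|_]; last first.
      by rewrite !mulr0 !addr0.
    by rewrite !mulr1 expRD; ring.
  rewrite quad_delta; last by case: sC.
  rewrite -/d.
  have -> : \sum_j (y + t *: delta_mx 0 i) 0 j = \sum_j y 0 j + t.
    rewrite (eq_bigr (fun j => y 0 j + t * (j == i)%:R)) => [|j _]; last first.
      by rewrite !mxE eqxx.
    rewrite big_split/=; congr (_ + _); rewrite (bigD1 i)//= eqxx mulr1 big1 ?addr0//.
    by move=> j /negbTE ->; rewrite mulr0.
  rewrite [X in _ <= 2^-1 * X - _ -> _]mxE [X in _ <= 2^-1 * (_ + X) - _ -> _]mxE eqxx mulr1n.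
  rewrite /psi expR0 subrr mul0r expr0n mul0r /a /b => H; lra.
have dpsi : is_derive (0 : R) 1 psi (a - 1).
  rewrite /psi; apply: is_derive_eq.
  by rewrite expR0 /GRing.scale/=; ring.
have d0 : is_derive (0 : R) 1 psi 0.
  apply: (@derive1_at_min R psi (-1) 1) => [|s _||s _].
  - by lra.
  - by rewrite /psi; exact: ex_derive.
  - by rewrite in_itv/= ltrN10 ltr01.
  - exact: psi0.
apply/eqP; rewrite -subr_eq0; apply/eqP.
by rewrite -/a -(@derive_val _ _ _ _ _ _ _ dpsi) (@derive_val _ _ _ _ _ _ _ d0).
Qed.

End Scaling.

(** * The isometries psi_OL and B *)

Section Isometries.
Context {R : realType} {m : nat}.

(** Both the rows of [Bmx] and their entrywise squares have this shape. *)
Lemma sum_staircase (i : 'I_m) (p q : R) :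
  \sum_(j < m.+1) (if (j <= i)%N then p else if j == i.+1 :> nat then q else 0) =
  i.+1%:R * p + q.
Proof.
rewrite -(big_mkord xpredT (fun j => if (j <= i)%N then p else if j == i.+1 then q else 0)).
rewrite (@big_cat_nat _ _ _ i.+1) //=; last exact: leq_trans (ltn_ord i) (leqnSn m).
congr (_ + _).
  rewrite (eq_big_nat _ _ (F2 := fun=> p)) => [|j /andP[_]]; last by rewrite ltnS => ->.
  by rewrite sumr_const_nat subn0 mulr_natl.
rewrite big_ltn ?ltnS// ltnn eqxx big_nat big1 ?addr0// => j /andP[ij _].
by rewrite leqNgt (ltn_trans (ltnSn i) ij)/= gtn_eqF.
Qed.

Lemma Bmx_row_sum (i : 'I_m) : \sum_j (Bmx : 'M[R]_(m, m.+1)) i j = 0.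
Proof.
under eq_bigr do rewrite mxE.
by rewrite sum_staircase addrN.
Qed.

(** For i < k, row k is constant on the support of row i, whose sum is zero. *)
Lemma Bmx_orthonormal : (Bmx : 'M[R]_(m, m.+1)) *m Bmx^T = 1%:M.
Proof.
have B0 (i k : 'I_m) : (i < k)%N -> \sum_j (Bmx : 'M[R]_(m, m.+1)) i j * Bmx k j = 0.
  move=> ik.
  rewrite (eq_bigr (fun j => (Bmx : 'M[R]_(m, m.+1)) i j * (Num.sqrt (k.+1 * k.+2)%:R)^-1)).
    by rewrite -mulr_suml Bmx_row_sum mul0r.
  move=> j _; rewrite !mxE; case: (leqP j i) => ji.
    by rewrite (leq_trans ji (ltnW ik)).
  by case: eqVneq => [->|_]; rewrite ?ik ?mul0r.
apply/matrixP => i k; rewrite !mxE; under eq_bigr do rewrite [_^T _ _]mxE.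
have [ik|ki|/val_inj ->] := ltngtP i k.
- by rewrite B0// (_ : (i == k) = false)//; apply/eqP => E; rewrite E ltnn in ik.
- under eq_bigr do rewrite mulrC.
  by rewrite B0// (_ : (i == k) = false)//; apply/eqP => E; rewrite E ltnn in ki.
rewrite eqxx /=; pose s : R := Num.sqrt (k.+1 * k.+2)%:R.
have s2 : s ^+ 2 = k.+1%:R * k.+2%:R by rewrite sqr_sqrtr// natrM.
have s0 : s != 0 by rewrite gt_eqF// sqrtr_gt0 ltr0n.
transitivity (\sum_(j < m.+1) (if (j <= k)%N then s^-1 ^+ 2 else
  if j == k.+1 :> nat then (k.+1%:R / s) ^+ 2 else 0)).
  apply: eq_bigr => j _; rewrite mxE -/s.
  by case: ifP => _; [|case: ifP => _]; rewrite -expr2 ?sqrrN ?expr0n.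
rewrite sum_staircase exprMn !exprVn s2.
have a0 : k.+1%:R != 0 :> R by rewrite pnatr_eq0.
have a1 : k.+2%:R != 0 :> R by rewrite pnatr_eq0.
move: a0 a1; rewrite -[k.+2%:R]natr1; move: (k.+1%:R) => a a0 a1.
by field; rewrite a0 a1.
Qed.

(** Adding the normalised constant row to [Bmx] gives a square orthogonal matrix Q, and Q^T Q = 1
    splits as the projection onto constants plus B^T B. *)
Lemma Bmx_projection : (Bmx : 'M[R]_(m, m.+1))^T *m Bmx = 1%:M - const_mx (m.+1%:R^-1).
Proof.
pose s : R := (Num.sqrt m.+1%:R)^-1.
have s2 : s ^+ 2 = m.+1%:R^-1 by rewrite exprVn sqr_sqrtr.
pose e : 'M[R]_(1, m.+1) := const_mx s.
have eB : e *m Bmx^T = 0.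
  apply/matrixP => i k; rewrite !mxE; under eq_bigr do rewrite 2!mxE.
  by rewrite -mulr_sumr Bmx_row_sum mulr0.
have ee : e *m e^T = 1%:M.
  apply/matrixP => i k; rewrite !mxE !ord1 eqxx; under eq_bigr do rewrite !mxE.
  by rewrite sumr_const card_ord -expr2 s2 -[LHS]mulr_natl divff// pnatr_eq0.
pose Q : 'M[R]_(1 + m, m.+1) := col_mx e Bmx.
have QQ : Q *m Q^T = 1%:M.
  rewrite /Q tr_col_mx mul_col_row ee eB Bmx_orthonormal.
  by rewrite -[Bmx *m e^T]trmxK trmx_mul trmxK eB trmx0 -scalar_mx_block.
have QQ' : Q^T *m Q = 1%:M by exact: (@mulmx1C _ m.+1 Q Q^T QQ).
rewrite -QQ' /Q tr_col_mx mul_row_col.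
rewrite (_ : const_mx _ = e^T *m e) ?[e^T *m e + _]addrC ?addrK//.
by apply/matrixP => i k; rewrite !mxE big_ord1 !mxE -expr2.
Qed.

Lemma row0_mul_const n (L : 'M[R]_n) a : row0 L -> L *m const_mx a = 0 :> 'M_n.
Proof.
move=> [_ L0]; apply/matrixP => i j; rewrite !mxE.
by under eq_bigr do rewrite mxE; rewrite -mulr_suml L0 mul0r.
Qed.

Lemma Bmx_row0K (L : 'M[R]_m.+1) : row0 L -> Bmx^T *m (Bmx *m L *m Bmx^T) *m Bmx = L.
Proof.
move=> rL; have [sL _] := rL.
rewrite !mulmxA -(mulmxA _ Bmx^T) !Bmx_projection mulmxBl mul1mx.
have -> : (const_mx m.+1%:R^-1 : 'M[R]_m.+1) *m L = 0.
  rewrite -[LHS]trmxK trmx_mul sL trmx_const.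
  by rewrite row0_mul_const// trmx0.
by rewrite subr0 mulmxBr mulmx1 row0_mul_const// subr0.
Qed.

Lemma Bmx_row0 (S : 'M[R]_m) : symm S -> row0 (Bmx^T *m S *m Bmx).
Proof.
move=> sS; split; first by rewrite /symm/= !trmx_mul trmxK sS mulmxA.
move=> i; have : (Bmx^T *m S *m Bmx *m (const_mx 1 : 'cV[R]_m.+1)) i 0 = 0.
  rewrite -mulmxA (_ : Bmx *m _ = 0) ?mulmx0 ?mxE//.
  apply/colP => k; rewrite !mxE; under eq_bigr do rewrite [const_mx _ _ _]mxE mulr1.
  exact: Bmx_row_sum.
by rewrite mxE; under eq_bigr do rewrite [const_mx _ _ _]mxE mulr1.
Qed.

Lemma trace_Bmx (L K : 'M[R]_m.+1) : row0 L -> row0 K ->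
  \tr ((Bmx *m L *m Bmx^T) *m (Bmx *m K *m Bmx^T)) = \tr (L *m K).
Proof.
move=> rL rK; rewrite -{2}(Bmx_row0K rL).
by rewrite [in LHS]mulmxA mxtrace_mulC [in RHS]mxtrace_mulC !mulmxA mxtrace_mulC !mulmxA.
Qed.

Lemma psi_OL_linear : linear (@psi_OL R m).
Proof.
move=> c S T; rewrite /psi_OL (@scale_block_mx _ 1 m 1 m) (@add_block_mx _ 1 m 1 m).
f_equal; rewrite ?scaler0 ?addr0//.
- by apply/rowP => i; rewrite !mxE; ring.
- by apply/colP => i; rewrite !mxE; ring.
apply/matrixP => i j; rewrite !mxE; case: (i == j); rewrite ?mulr1n ?mulr0n; ring.
Qed.

Lemma psi_OL_hol (S : 'M[R]_m) : symm S -> hol (psi_OL S).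
Proof.
move=> sS; split.
  rewrite /symm/= /psi_OL (@tr_block_mx _ 1 m 1 m) trmx0 trmxK; f_equal.
  by rewrite /off [(_ - _)^T]raddfB/= sS tr_diag_mx.
move=> i; rewrite /psi_OL; case: (@split_ordP 1 m i) => k ->.
  by rewrite (@block_mxEul _ 1 m 1 m) mxE.
by rewrite (@block_mxEdr _ 1 m 1 m) !mxE eqxx mulr1n subrr.
Qed.

(** Each of the two border blocks contributes half of sum S_ii T_ii, through the factors 1 / sqrt 2;
    together they restore the diagonal terms lost in [off]. *)
Lemma trace_psi_OL (S T : 'M[R]_m) : symm S -> symm T ->
  \tr (psi_OL S *m psi_OL T) = \tr (S *m T).
Proof.
move=> sS sT; rewrite /psi_OL (@mulmx_block _ 1 m 1 m 1 m) (@mxtrace_block _ 1 m).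
rewrite mul0mx add0r mxtraceD [\tr (_ *m (\col_i _)^T)]mxtrace_mulC.
have -> : \tr (off S *m off T) = \tr (S *m T) - \sum_i S i i * T i i.
  rewrite /mxtrace -sumrB; apply: eq_bigr => i _; rewrite !mxE.
  rewrite (bigD1 i)//= [in RHS](bigD1 i)//= !mxE eqxx !mulr1n !subrr mul0r add0r.
  rewrite [S i i * _ + _]addrC addrK; apply: eq_bigr => k ki; rewrite !mxE.
  by rewrite eq_sym (negbTE ki) !mulr0n !subr0.
have trE (d e : 'cV[R]_m) : \tr (d^T *m e) = \sum_i d i 0 * e i 0.
  by rewrite /mxtrace big_ord1 mxE; apply: eq_bigr => i _; rewrite mxE.
rewrite !trE addrA -big_split/= addrC.
rewrite [X in _ + X](eq_bigr (fun i => S i i * T i i)) ?subrK// => i _.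
rewrite !mxE.
have : (Num.sqrt 2 : R)^-1 ^+ 2 = 2^-1 by rewrite exprVn sqr_sqrtr.
move: (Num.sqrt 2)^-1 => a a2.
rewrite (_ : _ + _ = a ^+ 2 * 2 * (S i i * T i i)); last by ring.
by rewrite a2 mulVf ?mul1r// pnatr_eq0.
Qed.

End Isometries.

(** * Log-scaling expressed by unit row sums *)

Section LogScaling.
Context {R : realType} {n : nat}.
Implicit Types (A C : 'M[R]_n) (d : 'cV[R]_n).

Lemma row_sumE A i : (A *m (const_mx 1 : 'cV[R]_n)) i 0 = \sum_j A i j.
Proof. by rewrite mxE; apply: eq_bigr => j _; rewrite mxE mulr1. Qed.

Lemma row0_mlog A : spd A -> row0 (mlog A) <-> forall i, \sum_j A i j = 1.
Proof.
move=> /mlogP[sL eL]; have F := mexp_fixed (const_mx 1 : 'cV[R]_n) sL.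
rewrite eL in F; split=> [[_ L0] i|A1].
  have /F/colP/(_ i) : mlog A *m (const_mx 1 : 'cV[R]_n) = 0.
    by apply/colP => k; rewrite row_sumE L0 mxE.
  by rewrite row_sumE mxE.
split=> // i; have /F/colP/(_ i) : A *m (const_mx 1 : 'cV[R]_n) = const_mx 1.
  by apply/colP => k; rewrite row_sumE A1 mxE.
by rewrite row_sumE mxE.
Qed.

Lemma diag_congrE C (d : 'cV[R]_n) i j :
  (diag_mx d^T *m C *m diag_mx d^T) i j = d i 0 * C i j * d j 0.
Proof. by rewrite mul_mx_diag mxE mul_diag_mx !mxE. Qed.

Lemma spd_diag_congr C d : (forall i, 0 < d i 0) -> spd C ->
  spd (diag_mx d^T *m C *m diag_mx d^T).
Proof.
move=> d0 [sC pC]; split; first by rewrite /symm/= !trmx_mul tr_diag_mx sC mulmxA.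
move=> x x0; have -> : x^T *m (diag_mx d^T *m C *m diag_mx d^T) *m x =
    (diag_mx d^T *m x)^T *m C *m (diag_mx d^T *m x).
  by rewrite trmx_mul tr_diag_mx !mulmxA.
apply: pC; apply: contra x0 => /eqP/colP dx; apply/eqP/colP => i.
move/eqP: (dx i); rewrite mul_diag_mx !mxE mulf_eq0 gt_eqF//=.
by move/eqP.
Qed.

Lemma scales_row_sums C d : (forall i, 0 < d i 0) ->
  scales C d <-> forall i, \sum_j (diag_mx d^T *m C *m diag_mx d^T) i j = 1.
Proof.
move=> d0; have E i : \sum_j (diag_mx d^T *m C *m diag_mx d^T) i j = d i 0 * (C *m d) i 0.
  by rewrite mxE mulr_sumr; apply: eq_bigr => j _; rewrite diag_congrE mulrA.
by split=> [[_ dC] i|dC]; [rewrite E|split=> // i; rewrite -E].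
Qed.

(** A scaling vector shows that the set searched by [xget] is inhabited; uniqueness of that vector
    then identifies the element chosen. *)
Lemma scalingE C d : spd C -> scales C d -> scaling C = diag_mx d^T.
Proof.
move=> sC sd; have [d0 _] := sd.
have : [set D | pdiagonal D /\ row0 (mlog (D *m C *m D))] (scaling C).
  apply: xgetPex; exists (diag_mx d^T); split.
    split; first exact: diag_mx_is_diag.
    by move=> i; rewrite mxE eqxx mulr1n mxE.
  by apply/row0_mlog; [exact: spd_diag_congr|exact/scales_row_sums].
move=> [[/diagonalP[e eE] e0]]; rewrite eE.
have e0' i : 0 < e^T i 0 by have := e0 i; rewrite eE mxE eqxx mulr1n mxE.
rewrite -[e]trmxK => H.
have se : scales C e^T := (scales_row_sums C e0').2 ((row0_mlog (spd_diag_congr e0' sC)).1 H).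
by rewrite (scales_inj sC sd se).
Qed.

Lemma log_scalingE C d : spd C -> scales C d ->
  log_scaling C = mlog (diag_mx d^T *m C *m diag_mx d^T).
Proof. by move=> sC sd; rewrite /log_scaling (scalingE sC sd). Qed.

Lemma log_scaling_row0 C : spd C -> row0 (log_scaling C).
Proof.
move=> sC; have [d sd] := scales_exists sC; have [d0 _] := sd.
rewrite (log_scalingE sC sd); apply/row0_mlog; first exact: spd_diag_congr.
exact/scales_row_sums.
Qed.

End LogScaling.

Section InverseDiffeomorphism.
Context {R : realType} {m : nat}.
Implicit Types (C L : 'M[R]_m.+1) (X S : 'M[R]_m).

Lemma symm_conj_Bmx L : symm L -> symm (Bmx *m L *m Bmx^T).
Proof. by move=> sL; rewrite /symm/= !trmx_mul trmxK sL mulmxA. Qed.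

Lemma corr_of_congr C (d : 'cV[R]_m.+1) : (forall i, 0 < d i 0) -> (forall i, C i i = 1) ->
  corr_of (diag_mx d^T *m C *m diag_mx d^T) = C.
Proof.
move=> d0 C1; rewrite /corr_of; set D := (X in diag_mx X).
have DE i : D 0 i = (d i 0)^-1.
  by rewrite /D mxE diag_congrE C1 mulr1 -expr2 sqrtr_sqr gtr0_norm.
apply/matrixP => i j; rewrite mul_mx_diag mxE mul_diag_mx mxE diag_congrE !DE.
by field; rewrite !gt_eqF.
Qed.

(** Once a preimage is exhibited, the chosen X satisfies [Phi_LS X = C]. Then E = exp(B^T log X B)
    is C scaled by the square roots of the diagonal of E, and its logarithm has zero row sums;
    uniqueness of the scaling gives log E = [log_scaling C], and B B^T = 1 recovers log X. *)
Lemma mlog_Phi_LS_inv C : corr C -> mlog (Phi_LS_inv C) = Bmx *m log_scaling C *m Bmx^T.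
Proof.
move=> [sC C1]; have [d sd] := scales_exists sC; have [d0 dC] := sd.
have rL := log_scaling_row0 sC; have [sL _] := rL.
have : [set X | spd X /\ Phi_LS X = C] (Phi_LS_inv C).
  apply: xgetPex; exists (mexp (Bmx *m log_scaling C *m Bmx^T)).
  have sB := symm_conj_Bmx sL.
  split; first exact: mexp_symm.
  rewrite /Phi_LS mexpK// Bmx_row0K// (log_scalingE sC sd).
  have [_ ->] := mlogP (spd_diag_congr d0 sC).
  exact: corr_of_congr.
set X := Phi_LS_inv C => -[sX XC].
have [sS _] := mlogP sX; have rT := Bmx_row0 sS; have [sT _] := rT.
pose E := mexp (Bmx^T *m mlog X *m Bmx).
have sE : spd E := mexp_symm sT.
have E0 i : 0 < E i i.
  have := sE.2 (delta_mx i 0); rewrite trmx_delta -rowE -colE !mxE; apply.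
  by apply/eqP => /matrixP/(_ i 0)/eqP; rewrite !mxE !eqxx oner_eq0.
pose e : 'cV[R]_m.+1 := \col_i Num.sqrt (E i i).
have e0 i : 0 < e i 0 by rewrite mxE sqrtr_gt0.
have EE : diag_mx e^T *m C *m diag_mx e^T = E.
  apply/matrixP => i j; rewrite diag_congrE -XC /Phi_LS -/E /corr_of.
  rewrite mul_mx_diag mxE mul_diag_mx !mxE.
  by field; rewrite !gt_eqF ?sqrtr_gt0.
have se : scales C e.
  by apply/scales_row_sums => //; rewrite EE; apply/row0_mlog => //; rewrite mexpK.
rewrite (log_scalingE sC se) EE mexpK//.
rewrite !mulmxA Bmx_orthonormal mul1mx -mulmxA.
by rewrite Bmx_orthonormal mulmx1.
Qed.

(** Both outcomes of [xget] are diagonal: an element of the set, or the default 0. *)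
Lemma off_log_diagP (S : 'M[R]_m.+1) : diagonal (off_log_diag S).
Proof.
rewrite /off_log_diag; case: xgetP => [D _ []//|_].
by apply/diagonalP; exists 0; rewrite raddf0.
Qed.

Lemma coset_proj_eq (A B : 'M[R]_m.+1) : spd A -> spd B -> coset A = coset B ->
  coset_proj A = coset_proj B.
Proof.
move=> sA sB AB; rewrite /coset_proj.
case: pselect => // sA'; case: pselect => // sB'.
exact: eq_exist.
Qed.

Lemma coset_proj_Phi_LS_OL C : corr C -> coset_proj (Phi_LS_OL C) =
  coset_proj (mexp (psi_OL (Bmx *m log_scaling C *m Bmx^T))).
Proof.
move=> cC; rewrite /Phi_LS_OL /= /Phi_OL (mlog_Phi_LS_inv cC).
have [sC _] := cC; have [sL _] := log_scaling_row0 sC.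
have [sp _] := psi_OL_hol (symm_conj_Bmx sL).
set S := psi_OL _ in sp *.
have /diagonalP[d ->] := off_log_diagP S; rewrite addrC.
apply: coset_proj_eq; last exact: coset_mexpD.
  by apply: mexp_symm; rewrite /symm/= raddfD/= sp tr_diag_mx.
exact: mexp_symm.
Qed.

End InverseDiffeomorphism.

(** * Derivatives along curves *)

Section Curves.
Context {R : realType}.

(** With a real parameter, functions that agree only on [spd] or [corr] can be exchanged as soon as
    the line stays in that set near 0. *)
Lemma derive_line (V W : normedModType R) (f : V -> W) (a v : V) :
  'D_v f a = 'D_1 (fun h : R => f (h *: v + a)) 0.
Proof.
rewrite /derive.
suff -> : (fun h : R => h^-1 *: ((f \o shift a) (h *: v) - f a)) = (fun h : R => h^-1 *:
    (((fun h : R => f (h *: v + a)) \o shift 0) (h *: 1) - f (0 *: v + a))) by [].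
by apply/funext => h /=; rewrite scale0r add0r addr0 [_ *: 1]mulr1.
Qed.

Lemma derivable_line (V : normedModType R) (a v : V) (t : R) :
  is_derive t 1 (fun h : R => h *: v + a) v.
Proof.
have d := is_diffD (is_diff_scalel t v) (is_diff_cst a t).
have dd : differentiable (fun h : R => h *: v + a) t := ex_diff (is_diff_def := d).
apply: DeriveDef; first exact/derivable1_diffP.
by rewrite deriveE// (@diff_val _ _ _ _ _ _ _ d) /= addr0 scale1r.
Qed.

Lemma derivable_mx_linear (m n p q : nat) (f : 'M[R]_(m, n) -> 'M[R]_(p, q))
  (g : R -> 'M[R]_(m, n)) : linear f -> derivable g 0 1 ->
  derivable (f \o g) 0 1 /\ 'D_1 (f \o g) 0 = f ('D_1 g 0).
Proof.
move=> lf /derivable1_diffP dg; have df := is_diff_mx_linear (g 0) lf.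
have dc : differentiable (f \o g) 0 by apply: differentiable_comp => //; exact: ex_diff.
split; first exact/derivable1_diffP.
by rewrite !deriveE// diff_comp//= diff_val.
Qed.

Lemma near_line_spd n (A v : 'M[R]_n) : spd A -> symm v ->
  \forall h \near (0 : R), spd (h *: v + A).
Proof.
move=> sA sv.
have cl : {for (0 : R), continuous (fun h : R => h *: v + A)}.
  apply/differentiable_continuous/derivable1_diffP.
  by have [] := derivable_line A v 0.
have nA : \forall B \near ((0 : R) *: v + A), symm B -> spd B.
  by rewrite scale0r add0r; exact: near_spd.
have nl : \forall h \near (0 : R), symm (h *: v + A) -> spd (h *: v + A) := cl _ nA.
apply: filterS nl => h; apply.
by rewrite /symm/= raddfD/= linearZ/= sv sA.1.
Qed.

Lemma derivable_ext_curve n (U : set 'M[R]_n) (F f : 'M[R]_n -> R) (g : R -> 'M[R]_n) :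
  open U -> U (g 0) -> differentiable F (g 0) ->
  (forall y, U y -> spd y -> F y = f y) -> derivable g 0 1 ->
  (\forall h \near (0 : R), spd (g h)) ->
  derivable (f \o g) 0 1 /\ 'D_1 (f \o g) 0 = 'd F (g 0) ('D_1 g 0).
Proof.
move=> oU Ug dF Ff /derivable1_diffP dg sg.
have cg := differentiable_continuous dg.
have nU : \forall h \near (0 : R), U (g h) by exact: cg (open_nbhs_nbhs (conj oU Ug)).
have e : {near (0 : R), F \o g =1 f \o g}.
  by apply: filterS2 nU sg => h Uh sh; exact: Ff.
have dc : differentiable (F \o g) 0 by exact: differentiable_comp.
split; first by apply: near_eq_derivable e _; exact/derivable1_diffP.
by rewrite -(near_eq_derive _ e) !deriveE// diff_comp.
Qed.

Lemma symm_derive n (g : R -> 'M[R]_n) : derivable g 0 1 ->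
  (\forall h \near (0 : R), symm (g h)) -> symm ('D_1 g 0).
Proof.
move=> dg sg; have lt : linear (@trmx R n n).
  by move=> c X Y; rewrite linearP.
have [_] := derivable_mx_linear lt dg; rewrite /symm/= => <-.
by apply: near_eq_derive; apply: filterS sg.
Qed.

(* Both sides are derivatives along curves inside spd with the same velocity, on
   which f coincides with a differentiable extension. *)
Lemma derive_smooth_curve n (f : 'M[R]_n -> R) (g : R -> 'M[R]_n) :
  smooth_on spd f -> derivable g 0 1 -> (\forall h \near (0 : R), spd (g h)) ->
  derivable (f \o g) 0 1 /\ 'D_1 (f \o g) 0 = 'D_('D_1 g 0) f (g 0).
Proof.
move=> smf dg sg; have sg0 := nbhs_singleton sg.
have [U [F [oU Ug CF Ff]]] := smf _ sg0.
have [/(_ _ Ug) dF _] := CF 1%N.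
have [df ->] := derivable_ext_curve oU Ug dF Ff dg sg.
split=> //; rewrite (derive_line f).
have sw : symm ('D_1 g 0) by apply: symm_derive => //; apply: filterS sg => h [].
have line0 : (0 : R) *: 'D_1 g 0 + g 0 = g 0 by rewrite scale0r add0r.
have := derivable_ext_curve (g := fun h : R => h *: 'D_1 g 0 + g 0) oU _ _ Ff _
  (near_line_spd sg0 sw).
rewrite line0; have [dl ->] := derivable_line (g 0) ('D_1 g 0) (0 : R).
by move=> /(_ Ug dF dl)[_ <-].
Qed.

Lemma derive_mlog_curve n (g : R -> 'M[R]_n) :
  derivable g 0 1 -> (\forall h \near (0 : R), spd (g h)) ->
  derivable (@mlog R n \o g) 0 1 /\ 'D_1 (@mlog R n \o g) 0 = 'D_('D_1 g 0) (@mlog R n) (g 0).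
Proof.
move=> dg sg; have E i j := derive_smooth_curve (@smooth_mlog R n i j) dg sg.
have dm : derivable (@mlog R n \o g) 0 1 by apply/derivable_mxP => i j; case: (E i j).
split; first exact: dm.
have sg0 := nbhs_singleton sg.
have sw : symm ('D_1 g 0) by apply: symm_derive => //; apply: filterS sg => h [].
pose l (h : R) := h *: 'D_1 g 0 + g 0.
have sl : \forall h \near (0 : R), spd (l h) := near_line_spd sg0 sw.
have [dl lE] : is_derive (0 : R) 1 l ('D_1 g 0) := derivable_line (g 0) ('D_1 g 0) (0 : R).
have El i j := derive_smooth_curve (@smooth_mlog R n i j) dl sl.
have dml : derivable (@mlog R n \o l) 0 1 by apply/derivable_mxP => i j; case: (El i j).
rewrite (derive_line (@mlog R n)).
transitivity ('D_1 (@mlog R n \o l) 0); last by [].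
rewrite (derive_mx dm) (derive_mx dml).
apply/matrixP => i j; rewrite !mxE.
have [_ e1] := E i j; have [_ e2] := El i j.
have l0 : l 0 = g 0 by rewrite /l scale0r add0r.
transitivity ('D_('D_1 g 0) (fun A : 'M[R]_n => mlog A i j) (g 0)); first exact: e1.
by rewrite -l0 -[X in 'D_X _ _]lE; symmetry; exact: e2.
Qed.

End Curves.

(** * Differentiability of the scaling vector along lines *)

Section ScalingCurve.
Context {R : realType} {n : nat}.
Implicit Types (A B C u : 'M[R]_n) (d e : 'cV[R]_n).

Definition scaling_vec A : 'cV[R]_n := \col_i scaling A i i.

Lemma scaling_vecP A : spd A -> scales A (scaling_vec A).
Proof.
move=> sA; have [d sd] := scales_exists sA.
suff -> : scaling_vec A = d by [].
by apply/colP => i; rewrite mxE (scalingE sA sd) !mxE eqxx mulr1n.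
Qed.

(* The secant slope between d and e of the map x |-> B x - 1 / x. *)
Definition secant B d e : 'M[R]_n := B + diag_mx (\row_i (e i 0 * d i 0)^-1).

(** Subtract A d = 1/d from B e = 1/e. The divided difference of 1/x makes the relation exactly
    linear in e - d. *)
Lemma scales_secant A B d e : scales A d -> scales B e ->
  secant B d e *m (e - d) = (A - B) *m d.
Proof.
move=> [d0 dA] [e0 eB].
have ei i : (B *m e) i 0 = (e i 0)^-1.
  by apply: (mulfI (lt0r_neq0 (e0 i))); rewrite eB divff ?gt_eqF.
have di i : (A *m d) i 0 = (d i 0)^-1.
  by apply: (mulfI (lt0r_neq0 (d0 i))); rewrite dA divff ?gt_eqF.
apply/colP => i; rewrite /secant mulmxDl [LHS]mxE mul_diag_mx [X in _ + X]mxE.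
rewrite mulmxBr [X in X + _]mxE ei mulmxBl [RHS]mxE di.
rewrite [(- (B *m d)) i 0]mxE [(e - d) i 0]mxE [(- d) i 0]mxE [(\row_i _) 0 i]mxE.
by move: ((B *m d) i 0) => b; field; rewrite !gt_eqF.
Qed.

Lemma coercive_secant c B d e : (forall i, 0 < d i 0) -> (forall i, 0 < e i 0) ->
  coercive c B -> coercive c (secant B d e).
Proof.
move=> d0 e0 cB; apply: coercive_diag cB => i.
by rewrite mxE invr_ge0 mulr_ge0 ?ltW.
Qed.

Lemma cvg_line A u : h *: u + A @[h --> (0 : R)] --> A.
Proof.
have dl : differentiable (fun h : R => h *: u + A) (0 : R).
  by apply/derivable1_diffP; have [] := derivable_line A u (0 : R).
by have := differentiable_continuous dl; rewrite /prop_for /continuous_at scale0r add0r.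
Qed.

(** The increment solves a system with right-hand side -h u d, so it is at most (n / c) |h| |u d|,
    with c uniform near C. *)
Lemma cvg_scaling_vec C u : spd C -> symm u ->
  scaling_vec (h *: u + C) @[h --> (0 : R)] --> scaling_vec C.
Proof.
move=> sC su; have [c c0 cC] := near_coercive sC.
have nc : \forall h \near (0 : R), coercive c (h *: u + C) := @cvg_line C u _ cC.
have ns := near_line_spd sC su.
set d := scaling_vec C; pose K := n%:R / c * `|u *m d| + 1.
have K0 : 0 < K by rewrite ltr_wpDl// mulr_ge0// divr_ge0// ltW.
apply/cvgrPdist_le => eps eps0.
have nh : \forall h \near (0 : R), `|h| <= eps / K by apply: nbhs0_le; rewrite divr_gt0.
apply: filterS3 nc ns nh => h ch sh hK.
have sd := scaling_vecP sC; have se := scaling_vecP sh.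
rewrite distrC; have cs := coercive_secant sd.1 se.1 ch.
apply: le_trans (coercive_norm _ c0 cs) _.
rewrite (scales_secant sd se) opprD addrCA subrr addr0 mulNmx normrN -scalemxAl normrZ.
rewrite mulrCA; apply: le_trans (_ : `|h| * K <= _); last by rewrite -ler_pdivlMr.
by rewrite ler_wpM2l// lerDl.
Qed.

(** The difference quotient solves M_h q = -u d and the candidate w solves M_0 w = -u d, where M_h
    is the secant matrix. Hence M_h (q - w) = (M_0 - M_h) w, which tends to 0, while the inverse of
    M_h stays bounded. *)
Lemma derivable_scaling_vec C u : spd C -> symm u ->
  derivable (fun h : R => scaling_vec (h *: u + C)) 0 1.
Proof.
move=> sC su; have [c c0 cC] := near_coercive sC.
have nc : \forall h \near (0 : R), coercive c (h *: u + C) := @cvg_line C u _ cC.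
have ns := near_line_spd sC su.
have sd := scaling_vecP sC; set d := scaling_vec C in sd *; have [d0 _] := sd.
have cM : coercive c (secant C d d).
  apply: coercive_secant => //; exact: nbhs_singleton cC.
have [w wE] : exists w, secant C d d *m w = - (u *m d).
  exists (invmx (secant C d d) *m - (u *m d)).
  by rewrite mulKVmx// (coercive_unit c0 cM).
pose s (h : R) := scaling_vec (h *: u + C).
have cs := cvg_scaling_vec sC su.
have csi i : s h i 0 @[h --> (0 : R)] --> d i 0.
  exact: cvg_comp cs (@coord_continuous R n 1 i 0 d).
have GE h i : ((secant C d d - secant (h *: u + C) d (s h)) *m w) i 0 =
    ((d i 0 * d i 0)^-1 - (s h i 0 * d i 0)^-1) * w i 0 - h * (u *m w) i 0.
  have SE (X Y : 'M[R]_n) : C + X - (h *: u + C + Y) = - (h *: u) + (X - Y).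
    by apply/matrixP => p q; rewrite !mxE; ring.
  rewrite /secant SE.
  rewrite -raddfB/= mulmxDl [LHS]mxE mul_diag_mx mulNmx -scalemxAl addrC; congr (_ + _).
    by rewrite mxE; congr (_ * _); rewrite !mxE.
  by rewrite mxE [X in - X]mxE.
have cG : (secant C d d - secant (h *: u + C) d (s h)) *m w @[h --> (0 : R)] --> (0 : 'cV[R]_n).
  apply: cvg_mx_entries => i j; rewrite ord1 mxE.
  rewrite (_ : (fun h : R => _) = (fun h : R => ((d i 0 * d i 0)^-1 - (s h i 0 * d i 0)^-1) * w i 0
    - h * (u *m w) i 0)); last by apply/funext => h; exact: GE.
  have c1 : (d i 0 * d i 0)^-1 - (s h i 0 * d i 0)^-1 @[h --> (0 : R)] -->
      (d i 0 * d i 0)^-1 - (d i 0 * d i 0)^-1.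
    apply: (@cvgB _ R _ (nbhs (0 : R))); first exact: cvg_cst.
    apply: (@cvgV _ _ (nbhs (0 : R))); first by rewrite mulf_neq0 ?gt_eqF.
    by apply: (@cvgM _ _ (nbhs (0 : R))); [exact: csi|exact: cvg_cst].
  have c2 : h * (u *m w) i 0 @[h --> (0 : R)] --> 0 * (u *m w) i 0.
    by apply: (@cvgM _ _ (nbhs (0 : R))); [exact: cvg_id|exact: cvg_cst].
  have c3 := cvgB (cvgM c1 (cvg_cst (w i 0))) c2.
  by move: c3; rewrite subrr !mul0r subr0; exact.
pose K := n%:R / c + 1.
have K0 : 0 < K by rewrite ltr_wpDl// divr_ge0// ltW.
apply/cvg_ex; exists w; apply/cvgrPdist_le => eps eps0.
have nG : \forall h \near (0 : R), `|(secant C d d - secant (h *: u + C) d (s h)) *m w| <= eps / K.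
  have eK : 0 < eps / K by rewrite divr_gt0.
  have nb : \forall h \near (0 : R),
      `|0 - (secant C d d - secant (h *: u + C) d (s h)) *m w| <= eps / K.
    exact: (cvgrPdist_le _ _).1 cG _ eK.
  by apply: filterS nb => h; rewrite sub0r normrN.
have n0 : \forall h \near (0 : R)^', h != 0 by exact: nbhs_dnbhs_neq.
have nA : \forall h \near (0 : R), [/\ coercive c (h *: u + C), spd (h *: u + C) &
    `|(secant C d d - secant (h *: u + C) d (s h)) *m w| <= eps / K].
  by apply: filterS3 nc ns nG => h.
have nA' : \forall h \near (0 : R)^', [/\ coercive c (h *: u + C), spd (h *: u + C) &
    `|(secant C d d - secant (h *: u + C) d (s h)) *m w| <= eps / K].
  by apply: cvg_within; exact: nA.
apply: filterS2 n0 nA' => h h0 [ch sh hG] /=.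
rewrite scale0r add0r addr0 [h *: 1]mulr1 -/(s h) -/d.
have se := scaling_vecP sh.
have cM' := coercive_secant d0 se.1 ch.
rewrite distrC; apply: le_trans (coercive_norm _ c0 cM') _.
have gen (X Y : 'M[R]_n) (y z b : 'cV[R]_n) : X *m y = - (h *: b) -> Y *m z = - b ->
    X *m (h^-1 *: y - z) = (Y - X) *m z.
  move=> Xy Yz; rewrite mulmxBr mulmxBl Yz -scalemxAr Xy scalerN scalerA mulVf//.
  by rewrite scale1r.
rewrite (gen _ _ _ _ _ _ wE); last first.
  by rewrite (scales_secant sd se) opprD addrCA subrr addr0 mulNmx -scalemxAl.
apply: (@le_trans _ _ (K * (eps / K))); last by rewrite mulrC divfK ?gt_eqF.
apply: ler_pM => //; first by rewrite divr_ge0// ltW.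
by rewrite lerDl.
Qed.

End ScalingCurve.

(** * The quotient submersion *)

Section QuotientCoordinates.
Context {R : realType} {n : nat}.

Lemma derive_mlog_entry (A v : 'M[R]_n) i j : spd A -> symm v ->
  ('D_v (@mlog R n) A) i j = 'D_v (fun B => mlog B i j) A.
Proof.
move=> sA sv; pose l (h : R) := h *: v + A.
have sl : \forall h \near (0 : R), spd (l h) := near_line_spd sA sv.
have [dl _] : is_derive (0 : R) 1 l v := derivable_line A v (0 : R).
have [dml _] := derive_mlog_curve dl sl.
rewrite (derive_line (@mlog R n)) (derive_line (fun B => mlog B i j)).
transitivity (('D_1 (@mlog R n \o l) 0) i j); first by [].
by rewrite (derive_mx dml) mxE.
Qed.

(** An arbitrary choice without any regularity: only off-diagonal entries of its logarithm are read,
    and these are constant on a coset. *)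
Definition coset_repr (q : @quot R n) : 'M[R]_n := s2val (cid2 (svalP q)).

Lemma coset_reprP (A : 'M[R]_n) : spd A ->
  spd (coset_repr (coset_proj A)) /\ coset (coset_repr (coset_proj A)) = coset A.
Proof.
move=> sA; rewrite /coset_repr; case: cid2 => B sB /= ->; split=> //.
by rewrite /coset_proj; case: pselect.
Qed.

Lemma mlog_coset_repr (A : 'M[R]_n) i j : spd A -> i != j ->
  mlog (coset_repr (coset_proj A)) i j = mlog A i j.
Proof.
move=> sA ij; have [sB BA] := coset_reprP sA.
have [d ->] := coset_eq_off sB sA BA.
by rewrite mxE [X in _ + X]mxE (negbTE ij) addr0.
Qed.

Lemma smooth_quot_off_mlog i j : i != j ->
  smooth_quot (fun q : @quot R n => mlog (coset_repr q) i j).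
Proof.
move=> ij A sA; have [U [F [oU UA CF FE]]] := @smooth_mlog R n i j A sA.
exists U, F; split=> // B UB sB /=.
by rewrite mlog_coset_repr// FE.
Qed.

Lemma vertical_diagonal (A v : 'M[R]_n) i j : spd A -> symm v ->
  dquot coset_proj A v = (fun _ => 0) -> i != j -> ('D_v (@mlog R n) A) i j = 0.
Proof.
move=> sA sv + ij; pose f : Coo := exist _ _ (smooth_quot_off_mlog ij).
move=> /(congr1 (@^~ f)) <-; rewrite derive_mlog_entry// /dquot.
rewrite (derive_line (fun B => mlog B i j)) (derive_line (ev f \o coset_proj)).
apply: near_eq_derive; apply: filterS (near_line_spd sA sv) => h sh.
by rewrite /= /ev /= mlog_coset_repr.
Qed.

Lemma trace_hol_diag (X Y : 'M[R]_n) : (forall i, X i i = 0) ->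
  (forall i j, i != j -> Y i j = 0) -> \tr (X *m Y) = 0.
Proof.
move=> X0 Y0; rewrite /mxtrace big1// => i _; rewrite mxE big1// => j _.
by have [->|ij] := eqVneq j i; rewrite ?X0 ?mul0r// Y0 ?mulr0.
Qed.

End QuotientCoordinates.

Section LogScalingCurve.
Context {R : realType} {n : nat}.
Implicit Types C u : 'M[R]_n.

Lemma derivable_log_scaling C u : spd C -> symm u ->
  derivable (fun h : R => log_scaling (h *: u + C)) 0 1.
Proof.
move=> sC su; pose s (h : R) := scaling_vec (h *: u + C).
have ds : derivable s 0 1 := derivable_scaling_vec sC su.
have [dl _] : is_derive (0 : R) 1 (fun h : R => h *: u + C) u := derivable_line C u (0 : R).
pose g (h : R) := diag_mx (s h)^T *m (h *: u + C) *m diag_mx (s h)^T.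
have ns := near_line_spd sC su.
have dg : derivable g 0 1.
  apply/derivable_mxP => i j.
  rewrite (_ : (fun h => g h i j) = (fun h => s h i 0) *
      (fun h => (h *: u + C) i j) * (fun h => s h j 0)).
    by apply: derivableM; [apply: derivableM|]; apply: (derivable_mxP _ _ _).1.
  by apply/funext => h; rewrite /g diag_congrE.
have sg : \forall h \near (0 : R), spd (g h).
  by apply: filterS ns => h sh; have [s0 _] := scaling_vecP sh; exact: spd_diag_congr.
have [dm _] := derive_mlog_curve dg sg.
apply: near_eq_derivable dm; apply: filterS ns => h sh /=.
by rewrite (log_scalingE sh (scaling_vecP sh)).
Qed.

Lemma row0_derive (L : R -> 'M[R]_n) : derivable L 0 1 ->
  (\forall h \near (0 : R), row0 (L h)) -> row0 ('D_1 L 0).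
Proof.
move=> dL nL; split; first by apply: symm_derive; [exact: dL|apply: filterS nL => h []].
move=> i; rewrite -row_sumE.
have lm : linear (fun X : 'M[R]_n => X *m (const_mx 1 : 'cV[R]_n)).
  by move=> c X Y; rewrite mulmxDl -scalemxAl.
have [_ <-] := derivable_mx_linear lm dL.
suff -> : 'D_1 ((fun X : 'M[R]_n => X *m (const_mx 1 : 'cV[R]_n)) \o L) 0 = 0 by rewrite mxE.
transitivity ('D_1 (cst (0 : 'cV[R]_n)) (0 : R)); last exact: derive_cst.
apply: near_eq_derive; apply: filterS nL => h [_ L0] /=.
by apply/colP => k; rewrite row_sumE L0 mxE.
Qed.

End LogScalingCurve.

(** * The horizontal lift and the pullback metric *)

Section Pullback.
Context {R : realType} {m : nat}.
Implicit Types C u v : 'M[R]_m.+1.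

Definition section_log (L : 'M[R]_m.+1) : 'M[R]_m.+1 := psi_OL (Bmx *m L *m Bmx^T).

Lemma section_log_linear : linear section_log.
Proof.
move=> c X Y; rewrite /section_log mulmxDr mulmxDl -scalemxAr -scalemxAl.
exact: psi_OL_linear.
Qed.

(** The point of the coset of [Phi_LS_OL C] whose logarithm has zero diagonal. That logarithm is
    linear in [log_scaling C], which makes the lift differentiable. *)
Definition log_scaling_lift C := mexp (section_log (log_scaling C)).

Lemma log_scaling_liftP C : spd C -> spd (log_scaling_lift C) /\
  mlog (log_scaling_lift C) = section_log (log_scaling C).
Proof.
move=> sC; have [sL _] := log_scaling_row0 sC.
have [sS _] := psi_OL_hol (symm_conj_Bmx sL).
by split; [exact: mexp_symm|exact: mexpK].
Qed.

Definition lift_tangent C u := 'D_1 (fun h : R => log_scaling_lift (h *: u + C)) 0.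

Lemma lift_tangentP C u : spd C -> symm u ->
  [/\ derivable (fun h : R => log_scaling_lift (h *: u + C)) 0 1,
      symm (lift_tangent C u), row0 ('D_u (@log_scaling R m.+1) C) &
      'D_(lift_tangent C u) (@mlog R m.+1) (log_scaling_lift C) =
        section_log ('D_u (@log_scaling R m.+1) C)].
Proof.
move=> sC su; have ns := near_line_spd sC su.
pose L (h : R) := log_scaling (h *: u + C).
have dL : derivable L 0 1 := derivable_log_scaling sC su.
have [dW WE] := derivable_mx_linear section_log_linear dL.
pose A (h : R) := log_scaling_lift (h *: u + C).
have dA : derivable A 0 1.
  apply/derivable1_diffP; apply: (@differentiable_comp _ _ _ _ (section_log \o L) (@mexp R m.+1)).
    exact/derivable1_diffP.
  exact: differentiable_mexp.
have nA : \forall h \near (0 : R), spd (A h).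
  by apply: filterS ns => h sh; case: (log_scaling_liftP sh).
have A0 : A 0 = log_scaling_lift C by rewrite /A scale0r add0r.
have [_ ME] := derive_mlog_curve dA nA.
split; first exact: dA.
- by apply: symm_derive; [exact: dA|apply: filterS nA => h []].
- rewrite (derive_line (@log_scaling R m.+1)); apply: row0_derive; first exact: dL.
  by apply: filterS ns => h sh; exact: log_scaling_row0.
(* Along the line, [mlog] of the lifted curve equals [section_log] of [L] near 0; the claim is the
   derivative of this identity. *)
rewrite -A0 /lift_tangent -ME (derive_line (@log_scaling R m.+1)) -WE.
apply: near_eq_derive; apply: filterS ns => h sh /=.
by case: (log_scaling_liftP sh).
Qed.

Lemma near_corr C u : corr C -> hol u -> \forall h \near (0 : R), corr (h *: u + C).
Proof.
move=> [sC C1] [su u0]; apply: filterS (near_line_spd sC su) => h sh; split=> // i.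
by rewrite mxE [X in X + _]mxE u0 mulr0 add0r C1.
Qed.

(** The two maps into the quotient are known to agree on correlation matrices only; a direction in
    [hol] keeps the unit diagonal, so the line stays there near 0. For the lift, each smooth
    function on the quotient is differentiated along the lifted curve by the chain rule. *)
Lemma dquot_Phi_LS_OL C u : corr C -> hol u ->
  dquot (coset_proj \o Phi_LS_OL) C u =
  dquot coset_proj (log_scaling_lift C) (lift_tangent C u).
Proof.
move=> cC hu; have [sC _] := cC; have [su _] := hu.
have [dA _ _ _] := lift_tangentP sC su.
have nA : \forall h \near (0 : R), spd (log_scaling_lift (h *: u + C)).
  by apply: filterS (near_line_spd sC su) => h sh; case: (log_scaling_liftP sh).
apply/funext => f; rewrite /dquot.
have [_] := derive_smooth_curve (svalP f) dA nA.
rewrite scale0r add0r => <-.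
rewrite (derive_line (ev f \o (coset_proj \o Phi_LS_OL))).
apply: near_eq_derive; apply: filterS (near_corr cC hu) => h ch /=.
by rewrite coset_proj_Phi_LS_OL.
Qed.

Lemma horizontal_lift_tangent C u : spd C -> symm u ->
  horizontal g_LE (log_scaling_lift C) (lift_tangent C u).
Proof.
move=> sC su; have [_ sa rL aE] := lift_tangentP sC su.
have [sA _] := log_scaling_liftP sC.
split=> // v sv v0; rewrite /g_LE /pullback_frobenius aE.
apply: trace_hol_diag => [|i j ij]; last exact: vertical_diagonal.
by have [sL _] := rL; have [] := psi_OL_hol (symm_conj_Bmx sL).
Qed.

End Pullback.

Theorem corollary4p26 (R : realType) (m : nat) (hn : (2 <= m.+1)%N)
  (gQ : quot_metric R m.+1) (hgQ : riemannian_submersion_coset_proj g_LE gQ)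
  (C u v : 'M[R]_m.+1) (hC : corr C) (hu : hol u) (hv : hol v) :
  g_LS C u v = pullback_quot (coset_proj \o Phi_LS_OL) gQ C u v.
Proof.
have [sC _] := hC; have [su _] := hu; have [sv _] := hv.
have [_ _ isometric] := hgQ; have [sA _] := log_scaling_liftP sC.
rewrite /pullback_quot !dquot_Phi_LS_OL// /= coset_proj_Phi_LS_OL//.
rewrite (isometric _ sA _ _ (horizontal_lift_tangent sC su) (horizontal_lift_tangent sC sv)).
have [_ _ ru uE] := lift_tangentP sC su; have [_ _ rv vE] := lift_tangentP sC sv.
have gE : g_LE (log_scaling_lift C) (lift_tangent C u) (lift_tangent C v) =
    \tr (section_log ('D_u (@log_scaling R m.+1) C) *m
         section_log ('D_v (@log_scaling R m.+1) C)).
  exact: (congr2 (fun X Y : 'M[R]_m.+1 => \tr (X *m Y)) uE vE).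
rewrite gE; symmetry.
apply: etrans (trace_psi_OL (symm_conj_Bmx ru.1) (symm_conj_Bmx rv.1)) _.
exact: trace_Bmx ru rv.
Qed.
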